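(* Let $\Omega\subset\mathbb{R}^m$ be a bounded domain with $C^2$ boundary, $n\ge 1$, $G=\overline{\Omega}^n$, $T>0$ and $X^\circ=\{x_i^\circ\}_{i=1}^n\in G$. Suppose $F_i\in C([0,T]\times G;\mathbb{R}^m)$ for $i=1,\dots,n$. Then there exists a mild solution $X(t)=\{x_i(t)\}_{i=1}^n$ of $$\dot{x}_i(t)=H_i\big(t,X(t)\big)\quad(0<t<T),\qquad x_i(0)=x_i^\circ,\qquad i=1,\dots,n.$$ Moreover, if there exists $L>0$ such that $|F_i(t,X)-F_i(t,Y)|\le L\|X-Y\|$ for all $t\in[0,T]$, all $X,Y\in G$ and all $i=1,\dots,n$, then the mild solution is unique.
   Context: $\nu$ is the outward unit normal vector on $\partial\Omega$. For $X=\{x_i\}_{i=1}^n\in(\mathbb{R}^m)^n$, $\|X\|:=\max_{1\le i\le n}|x_i|$ with $|\cdot|$ the Euclidean norm. Define $P:\overline{\Omega}\times\mathbb{R}^m\to\mathbb{R}^m$ by $P(x,f):=f-(f\cdot\nu(x))\nu(x)$ if $x\in\partial\Omega$ and $f\cdot\nu(x)>0$, and $P(x,f):=f$ otherwise. Define $H_i:[0,T]\times G\to\mathbb{R}^m$ by $H_i(t,X):=P(x_i,F_i(t,X))$ for $X=\{x_i\}\in G$. Mild solution: $X(t)=\{x_i(t)\}_{i=1}^n$ is a mild solution if, for every $i=1,\dots,n$, $x_i\in C^0([0,T];\mathbb{R}^m)$, $x_i(t)\in\overline{\Omega}$, and $x_i(t)=x_i^\circ+\int_0^tH_i(s,X(s))\,ds$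 for all $t\in[0,T)$. *)

(* Defs.v *)
From HB Require Import structures.
From mathcomp Require Import all_boot all_order all_algebra.
From mathcomp Require Import all_classical all_reals all_analysis.

Set Implicit Arguments.
Unset Strict Implicit.
Unset Printing Implicit Defensive.

Import Order.TTheory GRing.Theory Num.Theory.
Import numFieldNormedType.Exports.

Local Open Scope classical_set_scope.
Local Open Scope ring_scope.

(* R^m is 'rV[R]_m, whose library norm is the sup norm; it is used only through
   the topology and the notion of bounded set it induces, and the Euclidean
   norm is [enorm].  A point X = {x_i} of (R^m)^n is the matrix X : 'M[R]_(n, m)
   whose i-th row is x_i. *)

Section Euclidean.
Context {R : realType} {m : nat}.

Definition dot (u v : 'rV[R]_m) : R := \sum_(k < m) u 0 k * v 0 k.

Definition enorm (u : 'rV[R]_m) : R := Num.sqrt (dot u u).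

Definition maxnorm {n : nat} (X : 'M[R]_(n, m)) : R :=
  \big[Num.max/0]_(i < n) enorm (row i X).

End Euclidean.

Section Domains.
Context {R : realType} {m : nat}.
Implicit Types (U Omega : set 'rV[R]_m) (rho : 'rV[R]_m -> R).

Definition boundary Omega : set 'rV[R]_m := closure Omega `\` interior Omega.

Definition bounded_domain Omega : Prop :=
  [/\ open Omega, connected Omega, Omega !=set0 & bounded_set Omega].

Definition partial (k : 'I_m) rho (x : 'rV[R]_m) : R :=
  'D_(delta_mx 0 k : 'rV[R]_m) rho x.

Definition gradient rho (x : 'rV[R]_m) : 'rV[R]_m :=
  \row_(k < m) partial k rho x.

(* Meant for open U, where it says that the iterated partial derivatives of
   order at most r exist and are continuous. *)
Fixpoint Cr_on (r : nat) U rho : Prop :=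
  {in U, continuous rho} /\
  if r is r'.+1 then
    forall k : 'I_m,
      (forall x, U x -> derivable rho x (delta_mx 0 k : 'rV[R]_m)) /\
      Cr_on r' U (partial k rho)
  else True.

Definition local_defining_function Omega (p : 'rV[R]_m) U rho : Prop :=
  [/\ open U, U p, Cr_on 2 U rho,
      (forall x, U x -> gradient rho x != 0) &
      forall x, U x -> (Omega x <-> rho x < 0)].

Definition C2_boundary Omega : Prop :=
  forall p, boundary Omega p ->
    exists U rho, local_defining_function Omega p U rho.

(* At a boundary point the outward unit normal is the normalized gradient of
   a local defining function; this vector does not depend on the function.
   The values of nu off the boundary are irrelevant. *)
Definition outward_unit_normal Omega (nu : 'rV[R]_m -> 'rV[R]_m) : Prop :=
  forall p, boundary Omega p ->
    exists U rho, local_defining_function Omega p U rho /\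
      nu p = (enorm (gradient rho p))^-1 *: gradient rho p.

End Domains.

Section System.
Context {R : realType} {m n : nat}.
Variables (Omega : set 'rV[R]_m) (nu : 'rV[R]_m -> 'rV[R]_m).

Definition config : set 'M[R]_(n, m) :=
  [set X | forall i : 'I_n, closure Omega (row i X)].

Definition P (x f : 'rV[R]_m) : 'rV[R]_m :=
  if `[< boundary Omega x >] && (0 < dot f (nu x))
  then f - dot f (nu x) *: nu x else f.

Variable F : 'I_n -> R -> 'M[R]_(n, m) -> 'rV[R]_m.

Definition H (i : 'I_n) (t : R) (X : 'M[R]_(n, m)) : 'rV[R]_m :=
  P (row i X) (F i t X).

(* The integral is the componentwise Lebesgue integral (H is discontinuous in
   X, so that Riemann integrability may fail). Integrability is required
   explicitly because [Rintegral] is a total function. *)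
Definition mild_solution (T : R) (X0 : 'M[R]_(n, m)) (X : R -> 'M[R]_(n, m)) :
    Prop :=
  forall i : 'I_n,
    {within `[0, T], continuous (fun t => row i (X t))} /\
    forall t, 0 <= t < T ->
      [/\ closure Omega (row i (X t)),
          (forall k : 'I_m, (@lebesgue_measure R).-integrable `[0, t]
             (fun s => (H i s (X s) 0 k)%:E)) &
          row i (X t) = row i X0 +
            \row_(k < m) (\int[@lebesgue_measure R]_(s in `[0, t])
                            H i s (X s) 0 k)].

End System.

(* Main.v *)
Require Import Defs.
From HB Require Import structures.
From mathcomp Require Import all_boot all_order all_algebra.
From mathcomp Require Import all_classical all_reals all_analysis.
From mathcomp Require Import measurable_realfun ring lra.

Set Implicit Arguments.
Unset Strict Implicit.
Unset Printing Implicit Defensive.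

Import Order.TTheory GRing.Theory Num.Theory.
Import numFieldNormedType.Exports.

Local Open Scope classical_set_scope.
Local Open Scope ring_scope.

(** Both parts rest on the geometry of the boundary and on the fact that a
    Lipschitz function of time is the integral of its derivative.

    Existence. The projected field [H] jumps at the boundary, so Peano's theorem
    does not apply. One runs an explicit Euler scheme whose velocities are the
    drift, or the drift minus a multiple [lam] of the normal at a nearby boundary
    point, with [lam] chosen slightly larger than the outward part of the drift:
    such a step, if short, remains in the closure of the domain, and one step
    length serves for all configurations by compactness ([viable_step]). The
    schemes are equi-Lipschitz, and a limit along an ultrafilter gives a Lipschitz
    trajectory in the closure. The velocities need not converge, but every linear
    inequality they satisfy near a given time passes to the increments of the
    limit ([euler_limit]). Hence at each time of differentiability the velocity of
    a particle is the drift in the interior, and the drift minus a nonnegative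
    multiple of the normal at the boundary. At a contact time with the boundary
    the velocity must moreover be tangential, since a defining function attains
    its maximum along the trajectory there ([contact_tangential]). The only vector
    with both properties is the projected drift. Finally, the limit is the
    integral of its derivative ([lipschitz_integral]): adding and subtracting a
    Lipschitz function and a multiple of time gives monotone functions, whose
    Stieltjes measures have Radon-Nikodym densities with respect to the Lebesgue
    measure.

    Uniqueness. A C^2 domain satisfies an exterior ball condition: for [x] on the
    boundary and [y] in the closure, [dot (nu x) (y - x)] is at most a constant
    times the square of the distance ([exterior_ball]). The multiples of the
    normals that are removed from the drifts of two solutions therefore contribute
    at most quadratically to the derivative of the squared distance, as does the
    difference of the drifts ([one_sided_lipschitz]). Gronwall's lemma for
    Lipschitz functions ([lipschitz_gronwall]) then gives equality before the
    final time, and continuity gives it at the final time.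

    The estimates use the sup norm of row vectors, for which the coordinatewise
    mean value theorem is immediate, and the scalar product [dot]. *)

(** * Sup norm and scalar product *)

Section MatrixNorm.
Context {R : realType}.

Lemma ler_coord_norm {p q : nat} (A : 'M[R]_(p, q)) i j : `|A i j| <= `|A|.
Proof.
rewrite {2}/Num.norm /= mx_normrE.
by rewrite (bigD1 (i, j)) //= le_max lexx.
Qed.

Lemma ler_norm_coord {p q : nat} (A : 'M[R]_(p, q)) c :
  0 <= c -> (forall i j, `|A i j| <= c) -> `|A| <= c.
Proof.
move=> c0 Ac; rewrite {1}/Num.norm /= mx_normrE.
by apply: bigmax_le => // -[i j] _; exact: Ac.
Qed.

Lemma ler_norm_row {p q : nat} (A : 'M[R]_(p, q)) i : `|row i A| <= `|A|.
Proof.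
by apply: ler_norm_coord => // i' j; rewrite mxE; exact: ler_coord_norm.
Qed.

Lemma ball_mxE {p q : nat} (A : 'M[R]_(p, q)) r B : ball A r B = (`|A - B| < r).
Proof. by rewrite mx_norm_ball. Qed.

End MatrixNorm.

Section Dot.
Context {R : realType} {m : nat}.
Implicit Types u v w : 'rV[R]_m.

Lemma dotC u v : dot u v = dot v u.
Proof. by apply: eq_bigr => k _; rewrite mulrC. Qed.

Lemma dotDr u v w : dot u (v + w) = dot u v + dot u w.
Proof. by rewrite -big_split; apply: eq_bigr => k _; rewrite mxE mulrDr. Qed.

Lemma dotZr c u v : dot u (c *: v) = c * dot u v.
Proof. by rewrite big_distrr; apply: eq_bigr => k _; rewrite mxE /= mulrCA. Qed.

Lemma dotNr u v : dot u (- v) = - dot u v.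
Proof. by rewrite -scaleN1r dotZr mulN1r. Qed.

Lemma dotBr u v w : dot u (v - w) = dot u v - dot u w.
Proof. by rewrite dotDr dotNr. Qed.

Lemma dotDl u v w : dot (u + v) w = dot u w + dot v w.
Proof. by rewrite !(dotC _ w) dotDr. Qed.

Lemma dotZl c u v : dot (c *: u) v = c * dot u v.
Proof. by rewrite !(dotC _ v) dotZr. Qed.

Lemma dotNl u v : dot (- u) v = - dot u v.
Proof. by rewrite !(dotC _ v) dotNr. Qed.

Lemma dotBl u v w : dot (u - v) w = dot u w - dot v w.
Proof. by rewrite !(dotC _ w) dotBr. Qed.

Lemma dot0r u : dot u 0 = 0.
Proof. by rewrite -(scale0r 0) dotZr mul0r. Qed.

Definition dotE := (dotBr, dotBl, dotDr, dotDl, dotZr, dotZl, dotNr, dotNl).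

Lemma dot_ge0 u : 0 <= dot u u.
Proof. by apply: sumr_ge0 => k _; rewrite -expr2 sqr_ge0. Qed.

Lemma ler_sqr_coord_dot u k : u 0 k ^+ 2 <= dot u u.
Proof.
rewrite /dot (bigD1 k) //= -expr2 lerDl.
by apply: sumr_ge0 => j _; rewrite -expr2 sqr_ge0.
Qed.

Lemma ler_norm_enorm u : `|u| <= enorm u.
Proof.
apply: ler_norm_coord => [|i k]; first exact: sqrtr_ge0.
by rewrite (ord1 i) -sqrtr_sqr ler_wsqrtr // ler_sqr_coord_dot.
Qed.

Lemma enorm_sqr u : enorm u ^+ 2 = dot u u.
Proof. by rewrite sqr_sqrtr // dot_ge0. Qed.

Lemma ler_sqr_norm_dot u : `|u| ^+ 2 <= dot u u.
Proof.
by rewrite -enorm_sqr ler_sqr ?nnegrE ?sqrtr_ge0 // ler_norm_enorm.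
Qed.

Lemma dot_eq0 u : (dot u u == 0) = (u == 0).
Proof.
apply/eqP/eqP => [u0|->]; last by rewrite dot0r.
apply/eqP; rewrite -normr_eq0 -sqrf_eq0 eq_le sqr_ge0 andbT.
by rewrite -u0 ler_sqr_norm_dot.
Qed.

Lemma dot_gt0 u : u != 0 -> 0 < dot u u.
Proof. by move=> u0; rewrite lt0r dot_eq0 u0 dot_ge0. Qed.

Lemma enorm_gt0 u : u != 0 -> 0 < enorm u.
Proof. by move=> u0; rewrite sqrtr_gt0 dot_gt0. Qed.

Lemma ler_norm_dot u v : `|dot u v| <= m%:R * (`|u| * `|v|).
Proof.
apply: (le_trans (ler_norm_sum _ _ _)).
rewrite mulr_natl -[X in _ *+ X]card_ord -sumr_const.
by apply: ler_sum => k _; rewrite normrM ler_pM // ler_coord_norm.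
Qed.

Lemma ler_dot u v : dot u v <= m%:R * (`|u| * `|v|).
Proof. by apply: le_trans (ler_norm_dot u v); exact: ler_norm. Qed.

Lemma dot_normalize u : u != 0 ->
  dot ((enorm u)^-1 *: u) ((enorm u)^-1 *: u) = 1.
Proof.
move=> /enorm_gt0 u0; rewrite !dotE -enorm_sqr expr2 mulrA mulrACA.
by rewrite mulVf ?mulr1 ?gt_eqF // mulVf // gt_eqF.
Qed.

Lemma ler1_norm_unit u : dot u u = 1 -> `|u| <= 1.
Proof.
by move=> u1; rewrite -(@ler_sqr _ `|u|) ?nnegrE // expr1n -u1 ler_sqr_norm_dot.
Qed.

End Dot.

(** * Increments of functions with continuous partial derivatives *)

Section MeanValue.
Context {R : realType}.

Lemma mean_value_from0 (f df : R -> R) (c : R) :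
  (forall s : R, `|s| <= `|c| -> is_derive s 1 f (df s)) ->
  exists2 s, `|s| <= `|c| & f c - f 0 = df s * c.
Proof.
move=> dfE.
have cf a b : (forall s, s \in `[a, b] -> `|s| <= `|c|) ->
    {within `[a, b], continuous f}.
  by move=> ab; apply: derivable_within_continuous => s /ab /dfE [].
have [c0|/ltW c0] := leP 0 c.
- have bnd s : s \in `[0, c] -> `|s| <= `|c|.
    by rewrite in_itv /= => /andP[s0 sc]; rewrite !ger0_norm.
  have dfi s : s \in `]0, c[ -> is_derive s 1 f (df s).
    by move=> sc; apply/dfE/bnd; exact: subset_itv_oo_cc.
  have [s /bnd sc fE] := MVT_segment c0 dfi (cf _ _ bnd).
  by exists s => //; rewrite fE subr0.
- have bnd s : s \in `[c, 0] -> `|s| <= `|c|.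
    by rewrite in_itv /= => /andP[s0 sc]; rewrite !ler0_norm // lerN2.
  have dfi s : s \in `]c, 0[ -> is_derive s 1 f (df s).
    by move=> sc; apply/dfE/bnd; exact: subset_itv_oo_cc.
  have [s /bnd sc fE] := MVT_segment c0 dfi (cf _ _ bnd).
  by exists s => //; rewrite -opprB fE sub0r mulrN opprK.
Qed.

Context {m : nat}.
Implicit Types (rho : 'rV[R]_m -> R) (y z w : 'rV[R]_m) (k : 'I_m).

Lemma is_derive_partial rho w k (s : R) :
  derivable rho (w + s *: delta_mx 0 k) (delta_mx 0 k) ->
  is_derive s 1 (fun u : R => rho (w + u *: delta_mx 0 k))
    (partial k rho (w + s *: delta_mx 0 k)).
Proof.
have E : (fun h : R => h^-1 *: (rho (w + (h *: 1 + s) *: delta_mx 0 k)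
                               - rho (w + s *: delta_mx 0 k))) =
         (fun h : R => h^-1 *: (rho (h *: delta_mx 0 k + (w + s *: delta_mx 0 k))
                               - rho (w + s *: delta_mx 0 k))).
  apply/funext => h; congr (_ *: (rho _ - _)).
  by rewrite scalerDl addrCA /GRing.scale /= mulr1.
by move=> rhod; split; rewrite ?/partial /derivable /derive /= E.
Qed.

(** Changing the coordinates one after the other reduces the increment to
    one-dimensional mean value theorems; this is why only partial derivatives
    enter, taken at points that may differ from one coordinate to the next. *)
Lemma mean_value_partial rho y z :
  (forall w k, `|w - y| <= `|z - y| ->
     derivable rho w (delta_mx 0 k : 'rV[R]_m)) ->
  exists2 xi : 'I_m -> 'rV[R]_m, (forall k, `|xi k - y| <= `|z - y|) &
    rho z - rho y = \sum_(k < m) partial k rho (xi k) * (z - y) 0 k.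
Proof.
move=> rhod.
pose w (j : nat) : 'rV[R]_m := \row_k (if (k < j)%N then z 0 k else y 0 k).
have w0 : w 0%N = y by apply/rowP => k; rewrite mxE.
have wm : w m = z by apply/rowP => k; rewrite mxE ltn_ord.
have wS k : w k.+1 = w k + (z - y) 0 k *: delta_mx 0 k.
  apply/rowP => i; rewrite !mxE eqxx /= ltnS leq_eqVlt -val_eqE /=.
  case: eqVneq => [/val_inj ->|_] /=; last by rewrite mulr0 addr0.
  by rewrite ltnn mulr1 addrC subrK.
have wB k s : `|s| <= `|(z - y) 0 k| ->
    `|w k + s *: delta_mx 0 k - y| <= `|z - y|.
  move=> sk; apply: ler_norm_coord => // i0 i; rewrite (ord1 i0) !mxE eqxx /=.
  case: (eqVneq i k) => [->|_] /=.
    rewrite ltnn mulr1 addrAC subrr add0r (le_trans sk) //.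
    exact: ler_coord_norm.
  rewrite mulr0 addr0; case: ifP => _; last by rewrite subrr normr0.
  by have := ler_coord_norm (z - y) 0 i; rewrite !mxE.
have step k : exists xi : 'rV[R]_m, `|xi - y| <= `|z - y| /\
    rho (w k.+1) - rho (w k) = partial k rho xi * (z - y) 0 k.
  have [s sk] := @mean_value_from0 (fun s => rho (w k + s *: delta_mx 0 k))
    (fun s => partial k rho (w k + s *: delta_mx 0 k)) ((z - y) 0 k)
    (fun s sk => is_derive_partial (rhod _ _ (wB _ _ sk))).
  rewrite -wS scale0r addr0 => E.
  by exists (w k + s *: delta_mx 0 k); split; [exact: wB|].
have [xi xiP] := choice step.
exists xi => [k|]; first by have [] := xiP k.
rewrite -{1}wm -{1}w0 -(@telescope_sumr _ 0 m (fun j => rho (w j))) // big_mkord.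
by apply: eq_bigr => k _; have [] := xiP k.
Qed.

Lemma ball_convex_dist (x y z w : 'rV[R]_m) r :
  `|y - x| < r -> `|z - x| < r -> `|w - y| <= `|z - y| -> `|w - x| < 3 * r.
Proof.
move=> yx zx wy.
have := ler_normD (w - y) (y - x); rewrite addrA subrK => h1.
have := ler_normB (z - x) (y - x); rewrite opprB addrA subrK => h2.
lra.
Qed.

Lemma gradientE k rho x : gradient rho x 0 k = partial k rho x.
Proof. by rewrite mxE. Qed.

Lemma sum_coord_le (c : R) (a b : 'I_m -> R) (u : 'rV[R]_m) : 0 <= c ->
  (forall k, `|a k - b k| <= c) ->
  `|\sum_(k < m) a k * u 0 k - \sum_(k < m) b k * u 0 k| <= m%:R * c * `|u|.
Proof.
move=> c0 abc; rewrite -sumrB (le_trans (ler_norm_sum _ _ _)) //.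
rewrite -mulrA mulr_natl -[X in _ *+ X]card_ord -sumr_const.
apply: ler_sum => k _.
by rewrite -mulrBl normrM ler_pM // ler_coord_norm.
Qed.

(** Continuity of the partial derivatives at [x] makes the intermediate points
    of the mean value formula irrelevant. Having both end points free is what
    allows a particle to start anywhere near a boundary point, not only on the
    boundary. *)
Lemma strict_derivative U rho x (eta : R) : open U -> U x ->
  Cr_on 1 U rho -> 0 < eta ->
  exists2 r, 0 < r & forall y z, `|y - x| < r -> `|z - x| < r ->
    U y /\ `|rho z - rho y - dot (gradient rho x) (z - y)| <= eta * `|z - y|.
Proof.
move=> oU Ux [_ Cp] eta0.
pose c := eta / (m%:R + 1).
have m0 : 0 < m%:R + 1 :> R by rewrite ltr_pwDr // ler0n.
have c0 : 0 < c by rewrite divr_gt0.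
have nearU : \forall w \near x, U w /\
    forall k, `|partial k rho x - partial k rho w| <= c.
  near=> w; split; first by near: w; exact: open_nbhs_nbhs.
  near: w; apply: filter_forall => k.
  have [_ [cpk _]] := Cp k.
  have /cvgrPdist_le := cpk x (mem_set Ux); exact.
have [r0 /= r0_gt0 r0P] := (nbhs_ballP _ _).1 nearU.
(* The intermediate points stay in the ball of radius [3 * (r0 / 3)]. *)
exists (r0 / 3); first by rewrite divr_gt0.
move=> y z yx zx.
have inB w : `|w - y| <= `|z - y| -> U w /\
    forall k, `|partial k rho x - partial k rho w| <= c.
  move=> wy; apply: r0P; rewrite ball_mxE distrC.
  by have := ball_convex_dist yx zx wy; rewrite mulrC divfK.
split; first by have [] := inB y; rewrite ?subrr ?normr0.
have [xi xiP ->] := @mean_value_partial rho y z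
  (fun w k wy => (Cp k).1 w (inB w wy).1).
rewrite (_ : dot _ _ = \sum_k partial k rho x * (z - y) 0 k); last first.
  by apply: eq_bigr => k _; rewrite gradientE.
have := sum_coord_le (z - y) (ltW c0)
  (fun k => (inB (xi k) (xiP k)).2 k); rewrite distrC => /le_trans; apply.
rewrite ler_wpM2r // /c mulrCA -[leRHS]mulr1 ler_pM2l //.
by rewrite ler_pdivrMr // mul1r lerDl.
Unshelve. all: by end_near. Qed.

Lemma Cr_onW U rho : Cr_on 2 U rho -> Cr_on 1 U rho.
Proof.
move=> [cr Cp]; split => // k; have [dk [ck _]] := Cp k; split => //.
Qed.

Lemma locally_lipschitz U rho x : open U -> U x -> Cr_on 1 U rho ->
  exists r C, [/\ 0 < r, 0 <= C & forall y z, `|y - x| < r -> `|z - x| < r ->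
    `|rho z - rho y| <= C * `|z - y|].
Proof.
move=> oU Ux Crho.
have [r r0 rP] := strict_derivative oU Ux Crho ltr01.
exists r, (1 + m%:R * `|gradient rho x|); split => //.
move=> y z yx zx; have [_ h1] := rP y z yx zx.
have h2 := ler_norm_dot (gradient rho x) (z - y).
rewrite -(subrK (dot (gradient rho x) (z - y)) (rho z - rho y)).
rewrite (le_trans (ler_normD _ _)) // mulrDl -mulrA.
exact: lerD.
Qed.

(** The remainder is quadratic around every base point [y] near [x], with one
    constant, because the first derivatives are Lipschitz there. *)
Lemma quadratic_remainder U rho x : open U -> U x -> Cr_on 2 U rho ->
  exists r C, [/\ 0 < r, 0 <= C & forall y z, `|y - x| < r -> `|z - x| < r ->
    `|rho z - rho y - dot (gradient rho y) (z - y)| <= C * `|z - y| ^+ 2].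
Proof.
move=> oU Ux C2.
have lipk k : exists rC : R * R, [/\ 0 < rC.1, 0 <= rC.2 &
    forall y z, `|y - x| < rC.1 -> `|z - x| < rC.1 ->
    `|partial k rho z - partial k rho y| <= rC.2 * `|z - y|].
  have [r [C rCP]] := locally_lipschitz oU Ux (C2.2 k).2.
  by exists (r, C).
have [rC rCP] := choice lipk.
have nearU : \forall w \near x, U w /\ forall k, `|w - x| < (rC k).1.
  near=> w; split; first by near: w; exact: open_nbhs_nbhs.
  near: w; apply: filter_forall => k; apply/nbhs_ballP.
  exists (rC k).1; first by have [] := rCP k.
  by move=> w; rewrite ball_mxE distrC.
have [r0 /= r0_gt0 r0P] := (nbhs_ballP _ _).1 nearU.
pose C := \big[Num.max/0]_k (rC k).2.
have C0 : 0 <= C.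
  by rewrite /C; elim/big_ind: _ => // [a b a0 b0|i _]; rewrite ?le_max ?a0 //; have [] := rCP i.
exists (r0 / 3), (m%:R * C); split; rewrite ?mulr_ge0 ?divr_gt0 //.
move=> y z yx zx.
have inB w : `|w - y| <= `|z - y| -> U w /\ forall k, `|w - x| < (rC k).1.
  move=> wy; apply: r0P; rewrite ball_mxE distrC.
  by have := ball_convex_dist yx zx wy; rewrite mulrC divfK.
have [xi xiP ->] := @mean_value_partial rho y z
  (fun w k wy => (C2.2 k).1 w (inB w wy).1).
rewrite (_ : dot _ _ = \sum_k partial k rho y * (z - y) 0 k); last first.
  by apply: eq_bigr => k _; rewrite gradientE.
rewrite expr2 !mulrA.
have := @sum_coord_le (C * `|z - y|) (fun k => partial k rho (xi k))
  (fun k => partial k rho y) (z - y); rewrite !mulrA; apply.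
  by rewrite mulr_ge0.
move=> k; have [_ Ck0 /(_ y (xi k))] := rCP k.
move=> /(_ ((inB y _).2 k) ((inB _ (xiP k)).2 k)).
rewrite subrr normr0 normr_ge0 => /(_ isT) /le_trans; apply.
apply: ler_pM => //.
by rewrite /C (bigD1 k) //= le_max lexx.
Unshelve. all: by end_near. Qed.

End MeanValue.

(** * Defining functions and the outward normal *)

Section Limits.
Context {R : realType}.

Lemma cvg_max0 {I : Type} (G : set_system I) {GF : Filter G} (f : I -> R) a :
  f @ G --> a -> Num.max 0 (f x) @[x --> G] --> Num.max 0 a.
Proof.
move=> fa; apply/cvgrPdist_le => e e0.
move/cvgrPdist_le : fa => /(_ e e0); apply: filterS => x.
rewrite !ler_norml => /andP[h1 h2]; apply/andP.
by case: (leP 0 a); case: (leP 0 (f x)); split; lra.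
Qed.

Lemma near_dist_lt {p q : nat} (A : 'M[R]_(p, q)) r : 0 < r ->
  \forall B \near A, `|B - A| < r.
Proof.
move=> r0; apply/nbhs_ballP; exists r => // B.
by rewrite ball_mxE distrC.
Qed.

End Limits.

Section Boundary.
Context {R : realType} {m : nat}.
Implicit Types (Omega U : set 'rV[R]_m) (rho : 'rV[R]_m -> R).
Implicit Types (p q x y v g : 'rV[R]_m) (nu : 'rV[R]_m -> 'rV[R]_m).

Definition normalize g : 'rV[R]_m := (enorm g)^-1 *: g.

Lemma closure_boundary Omega x : boundary Omega x -> closure Omega x.
Proof. by case. Qed.

Lemma boundaryPn Omega x : open Omega -> boundary Omega x -> ~ Omega x.
Proof. by move=> oO [_ niO] Ox; apply: niO; apply: open_nbhs_nbhs. Qed.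

Lemma closure_notin_boundary Omega x :
  closure Omega x -> ~ boundary Omega x -> Omega x.
Proof.
by move=> cx nbx; apply: contrapT => nOx; apply: nbx; split=> // /interior_subset.
Qed.

Lemma defining_function_closure Omega p U rho x :
  local_defining_function Omega p U rho -> U x -> closure Omega x -> rho x <= 0.
Proof.
move=> [oU Up [crho _] _ UO] Ux clx; rewrite leNgt; apply/negP => rx.
have : \forall y \near x, U y /\ 0 < rho y.
  near=> y; split; first by near: y; exact: open_nbhs_nbhs.
  by near: y; apply: (cvgr_gt (rho x)) => //; exact: (crho x (mem_set Ux)).
move=> /clx [y [Oy [Uy ry]]]; have := (UO y Uy).1 Oy; lra.
Unshelve. all: by end_near. Qed.

Lemma defining_function_boundary Omega p U rho x : open Omega ->
  local_defining_function Omega p U rho -> U x -> boundary Omega x -> rho x = 0.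
Proof.
move=> oO rhoP Ux bx; apply/eqP; rewrite eq_le.
rewrite (defining_function_closure rhoP Ux (closure_boundary bx)) /=.
case: rhoP => _ _ _ _ UO; rewrite leNgt; apply/negP => rx.
exact: (boundaryPn oO bx ((UO x Ux).2 rx)).
Qed.

Lemma directional_expansion U rho x v (eta : R) : open U -> U x ->
  Cr_on 1 U rho -> 0 < eta ->
  exists2 r, 0 < r & forall t, 0 < t < r -> U (x + t *: v) /\
    `|rho (x + t *: v) - rho x - t * dot (gradient rho x) v| <= t * eta.
Proof.
move=> oU Ux C1 eta0.
have v0 : 0 < `|v| + 1 by rewrite ltr_pwDr.
have [r r0 rP] := strict_derivative oU Ux C1 (divr_gt0 eta0 v0).
exists (r / (`|v| + 1)); first by rewrite divr_gt0.
move=> t /andP[t0]; rewrite ltr_pdivlMr // => tr.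
have tv : `|x + t *: v - x| < r.
  by rewrite addrAC subrr add0r normrZ gtr0_norm // (le_lt_trans _ tr) // ler_pM2l // lerDl.
have xx : `|x - x| < r by rewrite subrr normr0.
split; first by have [] := rP _ _ tv xx.
have [_] := rP _ _ xx tv.
rewrite (addrAC x) subrr add0r dotZr => /le_trans; apply.
rewrite normrZ gtr0_norm // mulrCA ler_pM2l // mulrAC -mulrA -[leRHS]mulr1.
by rewrite ler_pM2l // ler_pdivrMr // mul1r lerDl.
Qed.

Lemma enormZ c g : 0 <= c -> enorm (c *: g) = c * enorm g.
Proof.
by move=> c0; rewrite /enorm !dotE mulrA -expr2 sqrtrM ?sqr_ge0 // sqrtr_sqr ger0_norm.
Qed.

(** The vectors tested are the component [w] of [g2] orthogonal to [g1], tilted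
    by [- e *: g1] into the open half space, and [- g1]. The first one forces
    [w = 0], the second one fixes the sign of the remaining factor. *)
Lemma normalize_eq g1 g2 : g1 != 0 -> g2 != 0 ->
  (forall v, dot g1 v < 0 -> dot g2 v <= 0) -> normalize g1 = normalize g2.
Proof.
move=> g1n0 g2n0 H12.
have d1 := dot_gt0 g1n0.
pose c := dot g2 g1 / dot g1 g1.
have [w wE] : exists w, w = g2 - c *: g1 by exists (g2 - c *: g1).
have w1 : dot g1 w = 0 by rewrite wE !dotE /c (dotC g2) divfK ?subrr ?gt_eqF.
have w2 : dot g2 w = dot w w by rewrite {2}wE dotBl dotZl w1 mulr0 subr0.
have w0 : w = 0.
  apply/eqP; rewrite -dot_eq0; apply: contraT => ww0.
  have {ww0}ww : 0 < dot w w by rewrite lt0r ww0 dot_ge0.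
  set b := dot g2 g1; have b0 : 0 < `|b| + 1 by rewrite ltr_pwDr.
  (* Small enough for [e * b] to stay below [dot w w]. *)
  pose e := dot w w / (`|b| + 1) / 2.
  have e0 : 0 < e by rewrite !divr_gt0.
  have := H12 (w - e *: g1); rewrite !dotE w1 w2 -/b sub0r oppr_lt0 mulr_gt0 //.
  move=> /(_ isT); rewrite subr_le0 => h.
  have h2 : e * b <= e * (`|b| + 1).
    by rewrite ler_pM2l // (le_trans (ler_norm b)) // lerDl.
  have h3 : e * (`|b| + 1) = dot w w / 2 by rewrite /e; field; rewrite gt_eqF.
  lra.
have g2E : g2 = c *: g1 by apply/eqP; rewrite -subr_eq0 -wE w0.
have c0 : 0 <= c.
  have := H12 (- g1); rewrite g2E !dotE !oppr_lt0 d1 => /(_ isT).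
  by rewrite mulrN oppr_le0 pmulr_lge0.
have {}c0 : 0 < c.
  rewrite lt0r c0 andbT; apply: contraNneq g2n0 => cE.
  by rewrite g2E cE scale0r.
rewrite /normalize g2E enormZ ?ltW // scalerA; congr (_ *: _).
by rewrite invfM -mulrA mulrC -mulrA mulfV ?mulr1 // gt_eqF.
Qed.

(** The sign of a defining function is dictated by the domain, so a direction
    that enters the domain according to one gradient cannot leave it according
    to the other. *)
Lemma normal_unique Omega p1 U1 rho1 p2 U2 rho2 x : open Omega ->
  local_defining_function Omega p1 U1 rho1 ->
  local_defining_function Omega p2 U2 rho2 ->
  U1 x -> U2 x -> boundary Omega x ->
  normalize (gradient rho1 x) = normalize (gradient rho2 x).
Proof.
move=> oO D1 D2 U1x U2x bx.
have r1 := defining_function_boundary oO D1 U1x bx.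
have r2 := defining_function_boundary oO D2 U2x bx.
case: D1 => oU1 _ /Cr_onW C1 g1 UO1; case: D2 => oU2 _ /Cr_onW C2 g2 UO2.
apply: normalize_eq; [exact: g1|exact: g2|].
move=> v v1; rewrite leNgt; apply/negP => v2.
have v1' : 0 < - dot (gradient rho1 x) v / 2 by rewrite divr_gt0 // oppr_gt0.
have v2' : 0 < dot (gradient rho2 x) v / 2 by rewrite divr_gt0.
have [s1 s10 s1P] := directional_expansion v oU1 U1x C1 v1'.
have [s2 s20 s2P] := directional_expansion v oU2 U2x C2 v2'.
pose t := Num.min s1 s2 / 2.
have t0 : 0 < t by rewrite divr_gt0 // lt_min s10.
have ts : t < Num.min s1 s2 by rewrite /t ltr_pdivrMr // mulr2n mulrDr mulr1 ltrDl lt_min s10.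
move: ts; rewrite lt_min => /andP[ts1 ts2].
have [U1t h1] : U1 (x + t *: v) /\ _ := s1P t (introT andP (conj t0 ts1)).
have [U2t h2] : U2 (x + t *: v) /\ _ := s2P t (introT andP (conj t0 ts2)).
move: h1 h2; rewrite r1 r2 !subr0 !ler_norml => /andP[_ h1] /andP[h2 _].
have p1' : t * dot (gradient rho1 x) v < 0 by rewrite pmulr_rlt0.
have p2' : 0 < t * dot (gradient rho2 x) v by rewrite mulr_gt0.
have /(UO1 _ U1t).2 /(UO2 _ U2t).1 : rho1 (x + t *: v) < 0 by lra.
lra.
Qed.

Lemma cvg_rV {T : Type} (F : set_system T) {FF : Filter F} (f : T -> 'rV[R]_m) g :
  (forall k, f x 0 k @[x --> F] --> g 0 k) -> f @ F --> g.
Proof.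
move=> fk; apply/cvgrPdist_le => e e0.
have : \forall x \near F, forall k, `|g 0 k - f x 0 k| <= e.
  by apply: filter_forall => k; move/cvgrPdist_le : (fk k); exact.
apply: filterS => x xk; apply: ler_norm_coord => [|i k]; first exact: ltW.
by rewrite (ord1 i) !mxE.
Qed.

Lemma cvg_rV_coord {T : Type} (F : set_system T) {FF : Filter F}
  (f : T -> 'rV[R]_m) g k : f @ F --> g -> f x 0 k @[x --> F] --> g 0 k.
Proof.
move=> fg; apply/cvgrPdist_le => e e0; move/cvgrPdist_le : fg => /(_ e e0).
apply: filterS => x; apply: le_trans.
by have := ler_coord_norm (g - f x) 0 k; rewrite !mxE.
Qed.

Lemma cvg_dot {T : Type} (F : set_system T) {FF : Filter F}
    (f1 f2 : T -> 'rV[R]_m) g1 g2 :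
  f1 @ F --> g1 -> f2 @ F --> g2 -> dot (f1 x) (f2 x) @[x --> F] --> dot g1 g2.
Proof.
move=> f1g f2g; rewrite /dot; apply: cvg_big => [|k _]; first exact: add_continuous.
by apply: cvgM; exact: cvg_rV_coord.
Qed.

Lemma cvg_enorm {T : Type} (F : set_system T) {FF : Filter F}
    (f : T -> 'rV[R]_m) g : f @ F --> g -> enorm (f x) @[x --> F] --> enorm g.
Proof.
move=> fg.
exact: (cvg_comp _ Num.sqrt (cvg_dot fg fg) (@sqrt_continuous R (dot g g))).
Qed.

Lemma gradient_continuous U rho x : U x -> Cr_on 1 U rho ->
  gradient rho y @[y --> x] --> gradient rho x.
Proof.
move=> Ux [_ C1].
apply: (@cvg_rV _ (nbhs x) (nbhs_filter x)) => k; rewrite gradientE.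
have [_ [ck _]] := C1 k.
under eq_fun do rewrite gradientE; exact: (ck x (mem_set Ux)).
Qed.

Section Normal.
Variables (Omega : set 'rV[R]_m) (nu : 'rV[R]_m -> 'rV[R]_m).
Hypotheses (oO : open Omega) (hnu : outward_unit_normal Omega nu).

Lemma normal_defining p U rho x : local_defining_function Omega p U rho ->
  U x -> boundary Omega x -> nu x = normalize (gradient rho x).
Proof.
move=> D Ux bx; have [U' [rho' [D' ->]]] := hnu bx.
by apply: (normal_unique oO D' D) => //; case: D'.
Qed.

Lemma normal_unit x : boundary Omega x -> dot (nu x) (nu x) = 1.
Proof.
move=> bx; have [U' [rho' [[_ Ux _ g0 _] ->]]] := hnu bx.
by rewrite dot_normalize // g0.
Qed.

Lemma normal_norm x : boundary Omega x -> `|nu x| <= 1.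
Proof. by move=> /normal_unit; exact: ler1_norm_unit. Qed.

Lemma normal_cvg p : boundary Omega p ->
  nu x @[x --> within (boundary Omega) (nbhs p)] --> nu p.
Proof.
move=> bp; have [U [rho [D nup]]] := hnu bp.
have [oU Up /Cr_onW C1 g0 _] := D.
have cn : normalize (gradient rho x) @[x --> p] --> normalize (gradient rho p).
  have cg := gradient_continuous Up C1.
  have gn0 : enorm (gradient rho p) != 0 by rewrite gt_eqF // enorm_gt0 // g0.
  exact: (cvgZ (cvgV gn0 (cvg_enorm cg)) cg).
rewrite nup.
refine (cvg_trans (near_eq_cvg _)
  (@cvg_within_filter _ _ _ _ _ _ (boundary Omega) cn)).
rewrite near_withinE.
near=> x => bx; rewrite (normal_defining D) //.
by near: x; exact: open_nbhs_nbhs.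
Unshelve. all: by end_near. Qed.

End Normal.
End Boundary.

(** * Uniform estimates at the boundary *)

Section ContactGeometry.
Context {R : realType} {m : nat}.
Variables (Omega : set 'rV[R]_m) (nu : 'rV[R]_m -> 'rV[R]_m).
Hypotheses (oO : open Omega) (bO : bounded_set Omega).
Hypotheses (hC2 : C2_boundary Omega) (hnu : outward_unit_normal Omega nu).
Implicit Types (p q x y f v : 'rV[R]_m).

Lemma closure_norm_bounded : exists2 B, 0 < B & forall x, closure Omega x -> `|x| <= B.
Proof.
have [B0 [_ B0P]] := bO.
exists (`|B0| + 2); first by rewrite ltr_wpDl.
move=> x /(_ (ball x 1) (nbhsx_ballx x _ ltr01)) [y [Oy]].
rewrite ball_mxE => xy.
have := B0P (`|B0| + 1) _ _ Oy.
rewrite (le_lt_trans (ler_norm _)) ?ltrDl // => /(_ isT) /= yB.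
have := ler_normD (x - y) y; rewrite subrK; lra.
Qed.

Lemma compact_closure : compact (closure Omega).
Proof.
have [B B0 BP] := closure_norm_bounded.
apply: bounded_closed_compact; last exact: closed_closure.
exists B; split; first exact: num_real.
by move=> r Br x /BP /le_trans; apply; exact: ltW.
Qed.

Lemma closed_boundary : closed (boundary Omega).
Proof.
rewrite /boundary setDE; apply: closedI; first exact: closed_closure.
exact/open_closedC/open_interior.
Qed.

Lemma compact_boundary : compact (boundary Omega).
Proof.
apply: (subclosed_compact closed_boundary compact_closure) => x.
exact: closure_boundary.
Qed.

(** Exterior ball condition: a ball of fixed radius touches the closure at [x]
    from outside, so that the lack of convexity costs only a quadratic error.
    It holds because [rho y <= 0 = rho x], the increment of [rho] being the
    scalar product with the gradient up to a quadratic remainder. *)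
Lemma exterior_ball_local p : boundary Omega p ->
  exists r C, [/\ 0 < r, 0 <= C & forall x y,
    boundary Omega x -> closure Omega y -> `|x - p| < r -> `|y - p| < r ->
    dot (nu x) (y - x) <= C * `|y - x| ^+ 2].
Proof.
move=> bp; have [U [rho D]] := hC2 bp.
have [oU Up C2 g0 _] := D.
have [r1 [C [r10 C0 CP]]] := quadratic_remainder oU Up C2.
pose a := enorm (gradient rho p) / 2.
have a0 : 0 < a by rewrite divr_gt0 // enorm_gt0 // g0.
have nearP : \forall x \near p, U x /\ a <= enorm (gradient rho x).
  near=> x; split; first by near: x; exact: open_nbhs_nbhs.
  near: x; apply: (cvgr_ge (enorm (gradient rho p))).
    exact: (cvg_enorm (gradient_continuous Up (Cr_onW C2))).
  by rewrite /a ltr_pdivrMr // mulr2n mulrDr mulr1 ltrDl enorm_gt0 // g0.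
have [r2 /= r20 r2P] := (nbhs_ballP _ _).1 nearP.
exists (Num.min r1 r2), (C / a); split.
- by rewrite lt_min r10.
- by rewrite divr_ge0 // ltW.
move=> x y bx cy; rewrite !lt_min => /andP[x1 x2] /andP[y1 y2].
have [Ux gx] := r2P x ltac:(by rewrite /= ball_mxE distrC).
have [Uy _] := r2P y ltac:(by rewrite /= ball_mxE distrC).
rewrite (normal_defining oO hnu D Ux bx) dotZl.
have := CP x y x1 y1.
rewrite (defining_function_boundary oO D Ux bx) subr0 ler_norml => /andP[h _].
have ry := defining_function_closure D Uy cy.
have h2 : dot (gradient rho x) (y - x) <= C * `|y - x| ^+ 2 by lra.
have gx0 : 0 < enorm (gradient rho x) by exact: lt_le_trans gx.
rewrite ler_pdivrMl // (le_trans h2) //.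
have ag : 1 <= enorm (gradient rho x) / a by rewrite ler_pdivlMr // mul1r.
have Cs0 : 0 <= C * `|y - x| ^+ 2 by rewrite mulr_ge0 // sqr_ge0.
have := ler_wpM2l Cs0 ag; rewrite mulr1 => /le_trans -> //.
by rewrite le_eqVlt; apply/orP; left; apply/eqP; field; rewrite gt_eqF.
Unshelve. all: by end_near. Qed.

(** Compactness of the boundary makes the local constant uniform; a point [y]
    far from [x] only needs a constant comparable to the inverse distance. *)
Lemma exterior_ball : exists2 C, 0 <= C & forall x y,
  boundary Omega x -> closure Omega y -> dot (nu x) (y - x) <= C * `|y - x| ^+ 2.
Proof.
have /compact_near_coveringP cov := compact_boundary.
have := cov R (pinfty_nbhs R) (fun C x => boundary Omega x ->
  forall y, closure Omega y -> dot (nu x) (y - x) <= C * `|y - x| ^+ 2) _.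
case=> [p bp|C0 [C0r C0P]]; last first.
  have C1 : C0 < Num.max 0 (C0 + 1) by rewrite lt_max ltrDl ltr01 orbT.
  exists (Num.max 0 (C0 + 1)); first by rewrite le_max lexx.
  by move=> x y bx; apply: (C0P _ C1 x bx bx).
have [r [C [r0 C_ge0 CP]]] := exterior_ball_local bp.
have r2 : 0 < r / 2 by rewrite divr_gt0.
near=> x C'; move=> /= bx y cy.
have xp : `|x - p| < r / 2 by near: x; exact: near_dist_lt.
have C'0 : 0 <= C' by near: C'; apply: nbhs_pinfty_ge; exact: num_real.
have [yp|yp] := ltP `|y - p| r.
  apply: le_trans (CP x y bx cy _ yp) _; first by lra.
  by rewrite ler_wpM2r ?sqr_ge0 //; near: C'; apply: nbhs_pinfty_ge; exact: num_real.
have xy : r / 2 <= `|y - x|.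
  have := ler_normD (y - x) (x - p); rewrite addrA subrK; lra.
apply: (@le_trans _ _ (m%:R * `|y - x|)).
  apply: (le_trans (ler_dot _ _)); rewrite ler_wpM2l // -[leRHS]mul1r.
  by rewrite ler_wpM2r // (normal_norm hnu).
have mC : m%:R <= C' * (r / 2).
  rewrite -ler_pdivrMr //; near: C'; apply: nbhs_pinfty_ge; exact: num_real.
rewrite expr2 mulrA ler_wpM2r // (le_trans mC) // ler_wpM2l //.
Unshelve. all: by end_near. Qed.

(** Velocities for an explicit step of a particle at [x] with drift [f]. The
    normal is taken at a boundary point within distance [e] of [x] because a
    particle inside the domain may be less than one step away from leaving
    it. *)
Definition admissible_velocity (K e : R) x f v : Prop :=
  v = f \/ exists p (lam : R), [/\ boundary Omega p, 0 <= lam <= K,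
    `|x - p| <= e & v = f - lam *: nu p].

Lemma admissible_velocity_norm K e x f v M : `|f| <= M -> 0 <= K ->
  admissible_velocity K e x f v -> `|v| <= M + K.
Proof.
move=> fM K0 [->|[p [lam [bp /andP[l0 lK] _ ->]]]].
  by rewrite (le_trans fM) // lerDl.
rewrite (le_trans (ler_normB _ _)) // lerD // normrZ ger0_norm //.
rewrite -[leRHS]mulr1; apply: ler_pM => //; exact: (normal_norm hnu).
Qed.

(** Removing the outward part of the drift is not enough, since a straight step
    tangent to the boundary may leave the domain. Pushing inwards by [e] more
    makes the derivative of the defining function along the step negative, with
    a margin that absorbs the error of the first order expansion; compactness
    of the closure provides one step length for all points. *)
Lemma viable_step (M e : R) : 0 <= M -> 0 < e ->
  \forall h \near 0^'+, forall x, closure Omega x -> forall f, `|f| <= M ->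
    exists2 v, admissible_velocity (m%:R * M + e) e x f v &
      closure Omega (x + h *: v).
Proof.
move=> M0 e0; have /compact_near_coveringP cov := compact_closure.
have := cov R (0^'+ : set_system R) (fun h x => closure Omega x ->
  forall f, `|f| <= M ->
    exists2 v, admissible_velocity (m%:R * M + e) e x f v &
      closure Omega (x + h *: v)) _.
move=> H; suff : \forall h \near 0^'+, closure Omega `<=`
    (fun x => closure Omega x -> forall f, `|f| <= M ->
    exists2 v, admissible_velocity (m%:R * M + e) e x f v &
      closure Omega (x + h *: v)).
  by apply: filterS => h hP x cx; exact: (hP x cx cx).
apply: H => p cp.
have small (r V : R) : 0 < r -> 0 <= V -> \forall h \near 0^'+, 0 < h /\ h * V < r.
  move=> r0 V0; have V1 : 0 < V + 1 by rewrite ltr_wpDl.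
  near=> h.
  have h0 : 0 < h by near: h; exact: nbhs_right_gt.
  split => //; apply: (@le_lt_trans _ _ (h * (V + 1))).
    by rewrite ler_pM2l // lerDl.
  rewrite -ltr_pdivlMr //; near: h; apply: nbhs_right_lt. by rewrite divr_gt0.
(* Away from the boundary a short step with the drift itself is harmless. *)
have [bp|/(closure_notin_boundary cp) Op] := pselect (boundary Omega p); last first.
  have [r /= r0 rP] := (nbhs_ballP _ _).1 (open_nbhs_nbhs (conj oO Op)).
  have r2 : 0 < r / 2 by rewrite divr_gt0.
  near=> x h; move=> /= cx f fM; exists f; first by left.
  have xp : `|x - p| < r / 2 by near: x; exact: near_dist_lt.
  have [h0 hM] : 0 < h /\ h * M < r / 2 by near: h; exact: small.
  apply: subset_closure; apply: rP; rewrite /= ball_mxE distrC addrAC.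
  apply: (le_lt_trans (ler_normD _ _)).
  have : `|h *: f| <= h * M by rewrite normrZ gtr0_norm // ler_pM2l.
  lra.
have [U [rho D]] := hC2 bp; have [oU Up /Cr_onW C1 g0 UO] := D.
pose V := M + (m%:R * M + e).
have mM0 : 0 <= m%:R * M by rewrite mulr_ge0.
have V0 : 0 < V by rewrite /V; lra.
pose G := enorm (gradient rho p).
have G0 : 0 < G by rewrite enorm_gt0 // g0.
have eta0 : 0 < e * G / 2 / V by rewrite !divr_gt0 // mulr_gt0.
have [r r0 rP] := strict_derivative oU Up C1 eta0.
have r2 : 0 < r / 2 by rewrite divr_gt0.
near=> x h; move=> /= cx f fM.
have xp : `|x - p| < r / 2 by near: x; exact: near_dist_lt.
have [h0 hV] : 0 < h /\ h * V < r / 2 by near: h; apply: small => //; exact: ltW.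
have fnu : dot f (nu p) <= m%:R * M.
  apply: (le_trans (ler_dot _ _)); rewrite ler_wpM2l // -[leRHS]mulr1.
  by apply: ler_pM => //; exact: (normal_norm hnu).
pose lam := Num.max 0 (dot f (nu p)) + e.
have lam0 : 0 <= lam by rewrite addr_ge0 ?le_max ?lexx // ltW.
have lamK : lam <= m%:R * M + e by rewrite lerD2r ge_max mM0.
have adm : admissible_velocity (m%:R * M + e) e x f (f - lam *: nu p).
  have xe : `|x - p| < e by near: x; exact: near_dist_lt.
  by right; exists p, lam; split; rewrite ?lam0 ?lamK // ltW.
exists (f - lam *: nu p) => //; set v := f - lam *: nu p.
have vV : `|v| <= V.
  by apply: (admissible_velocity_norm _ _ adm) => //; rewrite addr_ge0 // ltW.
have hv : `|h *: v| <= h * V by rewrite normrZ gtr0_norm // ler_pM2l.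
have x'p : `|x + h *: v - p| < r.
  rewrite addrAC (le_lt_trans (ler_normD _ _)) //; lra.
have [Ux _] := rP x x ltac:(lra) ltac:(lra).
have [Ux' _] := rP _ _ x'p x'p.
have := rP x _ ltac:(lra) x'p.
rewrite (addrAC x) subrr add0r ler_norml dotZr => -[_ /andP[_ h1]].
have rx := defining_function_closure D Ux cx.
have gE : gradient rho p = G *: nu p.
  by rewrite (normal_defining oO hnu D Up bp) scalerA mulfV ?scale1r // gt_eqF.
have gv : dot (gradient rho p) v <= - (e * G).
  rewrite gE !dotE (normal_unit hnu) // mulr1 (dotC _ f) -mulNr mulrC ler_pM2r //.
  have : dot f (nu p) <= Num.max 0 (dot f (nu p)) by rewrite le_max lexx orbT.
  by rewrite /lam; lra.
have hgv : h * dot (gradient rho p) v <= h * - (e * G) by rewrite ler_pM2l.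
have h2 : e * G / 2 / V * `|h *: v| <= h * (e * G / 2).
  apply: (le_trans (ler_wpM2l (ltW eta0) hv)).
  by rewrite le_eqVlt; apply/orP; left; apply/eqP; field; rewrite gt_eqF.
have h3 : 0 < h * (e * G) by rewrite !mulr_gt0.
apply: subset_closure; apply/(UO _ Ux'); lra.
Unshelve. all: by end_near. Qed.

End ContactGeometry.

(** * Lipschitz functions of time *)

Section LipschitzDensity.
Context {R : realType}.
Notation mu := (@lebesgue_measure R).

Lemma lebesgue_stieltjes_itvoc (f : cumulative R R) a b : a <= b ->
  lebesgue_stieltjes_measure f `]a, b]%classic = (f b - f a)%:E.
Proof.
move=> ab; rewrite /lebesgue_stieltjes_measure /measure_extension /=.
by rewrite measurable_mu_extE /= ?wlength_itv_bnd //; exact: is_ocitv.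
Qed.

(** The Lebesgue-Stieltjes measures of [f1] and [f2] add up to the Lebesgue
    measure, since both sides agree on half open intervals. The Lebesgue measure
    therefore dominates the first one, restricted to a bounded interval to be
    finite, and [g] is its Radon-Nikodym density. *)
Lemma cumulative_density (f1 f2 : cumulative R R) (T : R) :
  (forall t, f1 t + f2 t = t) ->
  exists g : R -> R, mu.-integrable setT (EFin \o g) /\
    forall t, 0 <= t <= T -> f1 t - f1 0 = \int[mu]_(s in `[0, t]) g s.
Proof.
move=> f12.
pose nu1 : {measure set (measurableTypeR R) -> \bar R} :=
  lebesgue_stieltjes_measure f1.
pose nu2 : {measure set (measurableTypeR R) -> \bar R} :=
  lebesgue_stieltjes_measure f2.
have nu1E a b : a <= b -> nu1 `]a, b]%classic = (f1 b - f1 a)%:E.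
  exact: lebesgue_stieltjes_itvoc.
have sumE A : measurable A -> mu A = (nu1 A + nu2 A)%E.
  move=> mA; rewrite -measure_addE; apply: lebesgue_measure_unique => //.
  move=> _ [[a b] _ <-]; rewrite -[RHS]/(measure_add nu1 nu2 _) measure_addE /=.
  have [ab|ba] := leP a b; last first.
    by rewrite set_itv_ge ?measure0 ?adde0 // bnd_simp -leNgt ltW.
  rewrite /lebesgue_measure !lebesgue_stieltjes_itvoc // -EFinD.
  congr EFin; rewrite /= -{1}(f12 b) -{1}(f12 a); ring.
have mD : measurable (`]0, T]%classic : set (measurableTypeR R)).
  exact: measurable_itv.
have nu1D : (nu1 `]0%R, T]%classic < +oo)%E.
  have [ab|ba] := leP 0 T; first by rewrite nu1E // ltry.
  by rewrite set_itv_ge ?measure0 // bnd_simp -leNgt ltW.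
have dom : mfrestr mD nu1D `<< mu.
  apply/null_content_dominatesP => A mA A0.
  apply/eqP; rewrite eq_le measure_ge0 andbT /mfrestr /mrestr.
  apply: (@le_trans _ _ (nu1 A)).
    by apply: le_measure; rewrite ?inE //; exact: measurableI.
  by have := sumE A mA; rewrite A0 => ->; rewrite leeDl.
have [g [g0 gfin gint gE]] := radon_nikodym_sigma_finite dom.
have gK : EFin \o (fine \o g) = g by apply/funext => x /=; rewrite fineK.
exists (fine \o g); split; first by rewrite gK.
move=> t /andP[t0 tT].
rewrite -Rintegral_itv_obnd_cbnd; last first.
  by rewrite gK; apply: integrableS gint => //; exact: measurable_itv.
rewrite /Rintegral (_ : (fun x => _) = g) ?gK // -gE //.
  rewrite -[X in fine X]/(nu1 (`]0, t] `&` `]0, T])%classic).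
  rewrite (_ : _ `&` _ = `]0, t]%classic); first by rewrite nu1E.
  apply/seteqP; split => x /=; rewrite !in_itv /=; first by case.
  by move=> /andP[-> xt]; rewrite xt (le_trans xt).
Qed.

Lemma lipschitz_cvg (V : normedModType R) (f : R -> V) (L : R) :
  (forall s t, `|f s - f t| <= L * `|s - t|) -> continuous f.
Proof.
move=> fL t; apply/cvgrPdist_le => e e0.
have L1 : 0 < `|L| + 1 by rewrite ltr_wpDl.
near=> s; apply: (le_trans (fL _ _)).
have : `|t - s| <= e / (`|L| + 1).
  by near: s; apply: cvgr_dist_le => //; rewrite divr_gt0.
rewrite ler_pdivlMr // mulrC; apply: le_trans.
by rewrite ler_wpM2r // (le_trans (ler_norm L)) // lerDl.
Unshelve. all: by end_near. Qed.

Lemma bounded_integrable_itv (h : R -> R) (a b B : R) :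
  measurable_fun `[a, b] h -> (forall s, a <= s <= b -> `|h s| <= B) ->
  mu.-integrable `[a, b] (EFin \o h).
Proof.
move=> mh hB; apply: (@measurable_bounded_integrable _ _ _ mu) => //.
- rewrite /= lebesgue_measure_itv /=.
  by case: ifP => _; rewrite ?ltry // -EFinB ltry.
- exists B; split; first exact: num_real.
  by move=> x Bx s /=; rewrite in_itv /= => /hB /le_trans; apply; exact: ltW.
Qed.

(** Extension by zero outside the segment reduces this to the fundamental
    theorem of calculus for functions integrable on the line. *)
Lemma is_derive_Rintegral (g : R -> R) (T : R) :
  mu.-integrable `[0, T] (EFin \o g) ->
  {ae mu, forall t, 0 < t < T ->
    is_derive t 1 (fun u : R => \int[mu]_(s in `[0, u]) g s) (g t)}.
Proof.
move=> gint; pose A : set R := `[0, T]%classic.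
have mA : measurable A by exact: measurable_itv.
have gA : mu.-integrable setT (EFin \o (g \_ A)).
  by rewrite -restrict_EFin -integrable_mkcond.
have gy y : mu.-integrable [set` Interval (BLeft 0) (BRight y)] (EFin \o (g \_ A)).
  by apply: integrableS gA => //; exact: measurable_itv.
have := FTC1 gy (integrable_locally mA gint).
apply: filterS; first exact: (ae_filter_ringOfSetsType mu).
move=> t /= H /andP[t0 tT].
move: H; rewrite lte_fin => /(_ t0) [d dE].
have gt : (g \_ A) t = g t.
  by rewrite patchE mem_set // /A /= in_itv /= !ltW.
rewrite -gt -dE.
have D : is_derive t 1 (fun u : R => \int[mu]_(s in `[0, u]) (g \_ A) s)
    (derive1 (fun u : R => \int[mu]_(s in `[0, u]) (g \_ A) s) t).
  by split => //; rewrite -derive1E.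
apply: near_eq_is_derive D.
near=> u; apply: eq_Rintegral => s; rewrite inE /= in_itv /= => /andP[s0 su].
rewrite patchE mem_set // /A /= in_itv /= s0 /= (le_trans su) //.
by near: u; apply: lt_le_nbhsl; exact: tT.
Unshelve. all: by end_near. Qed.

(** Rademacher's theorem on the line. As soon as [K] exceeds the Lipschitz
    constant, [(t + psi t / K) / 2] and [(t - psi t / K) / 2] are nondecreasing;
    they add up to the identity, so that the first one, hence [psi], is an
    indefinite integral. *)
Lemma lipschitz_integral (psi : R -> R) (L T : R) :
  (forall s t, `|psi s - psi t| <= L * `|s - t|) ->
  exists g : R -> R, [/\ mu.-integrable `[0, T] (EFin \o g),
    (forall t, 0 <= t <= T -> psi t = psi 0 + \int[mu]_(s in `[0, t]) g s) &
    {ae mu, forall t, 0 < t < T -> is_derive t 1 psi (g t)}].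
Proof.
move=> psiL; have L1 : 0 < `|L| + 1 by rewrite ltr_wpDl.
have psiL1 s t : `|psi s - psi t| <= (`|L| + 1) * `|s - t|.
  rewrite (le_trans (psiL _ _)) // ler_wpM2r //.
  by rewrite (le_trans (ler_norm L)) // lerDl.
set K := `|L| + 1 in L1 psiL1; clearbody K.
pose f1 (t : R) : R := (t + psi t / K) / 2.
pose f2 (t : R) : R := (t - psi t / K) / 2.
have bnd s t : s <= t -> - (t - s) <= (psi t - psi s) / K <= t - s.
  move=> st; have := psiL1 t s; rewrite mulrC (ger0_norm (x := t - s)) ?subr_ge0 //.
  by rewrite -ler_pdivrMr // -[K in _ / K]gtr0_norm // -normf_div ler_norml.
have f1nd : nondecreasing f1.
  by move=> s t /bnd /andP[h _]; rewrite /f1; lra.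
have f2nd : nondecreasing f2.
  by move=> s t /bnd /andP[_ h]; rewrite /f2; lra.
have cpsi : continuous psi by exact: lipschitz_cvg psiL.
have cK : continuous (fun t => psi t / K).
  by move=> t; apply: cvgM; [exact: cpsi|exact: cvg_cst].
have f1rc : right_continuous f1.
  apply: right_continuousW => t; apply: cvgM; last exact: cvg_cst.
  by apply: cvgD; [exact: cvg_id|exact: cK].
have f2rc : right_continuous f2.
  apply: right_continuousW => t; apply: cvgM; last exact: cvg_cst.
  by apply: cvgB; [exact: cvg_id|exact: cK].
pose F1 : cumulative R R := HB.pack f1 (isCumulative.Build R _ R f1 f1nd f1rc).
pose F2 : cumulative R R := HB.pack f2 (isCumulative.Build R _ R f2 f2nd f2rc).
have F12 t : F1 t + F2 t = t by rewrite /= /f1 /f2; field; rewrite gt_eqF.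
have [g1 [g1int g1E]] := cumulative_density T F12.
have mI t : measurable (`[0, t]%classic : set (measurableTypeR R)) by exact: measurable_itv.
have g1I t : mu.-integrable `[0, t] (EFin \o g1).
  by apply: integrableS g1int => //; exact: mI.
have muI t : 0 <= t -> mu (`[0, t]%classic : set R) = t%:E.
  move=> t0; rewrite lebesgue_measure_itv /= lte_fin.
  by case: ltgtP t0 => // [_|<-] _; rewrite ?sube0 // -EFinB subr0.
pose g t := (g1 t * 2 - 1) * K.
have cI t : mu.-integrable `[0, t] (EFin \o cst (1 : R)).
  by apply: (bounded_integrable_itv (B := 1)) => // ? _; rewrite normr1.
have g2I t : mu.-integrable `[0, t] (EFin \o (fun s => g1 s * 2)).
  rewrite (_ : _ \o _ = (fun s => 2%:E * (g1 s)%:E)%E).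
    by apply: integrableZl; [exact: mI|exact: g1I].
  by apply/funext => s /=; rewrite -EFinM mulrC.
have g3I t : mu.-integrable `[0, t] (EFin \o (fun s => g1 s * 2 - 1)).
  have := integrableB (mI t) (g2I t) (cI t).
  rewrite (_ : (_ \- _)%E = EFin \o (fun s => g1 s * 2 - 1)) //.
have gI t : mu.-integrable `[0, t] (EFin \o g).
  rewrite (_ : _ \o _ = (fun s => K%:E * (g1 s * 2 - 1)%:E)%E).
    by apply: integrableZl; [exact: mI|exact: g3I].
  by apply/funext => s /=; rewrite -EFinM mulrC.
have psiE t : 0 <= t <= T -> psi t = psi 0 + \int[mu]_(s in `[0, t]) g s.
  move=> t0T; have /andP[t0 tT] := t0T.
  rewrite /g RintegralZr // RintegralB //.
  rewrite RintegralZr // -g1E // Rintegral_cst //.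
  rewrite (_ : fine _ = t); last by rewrite -[RHS]/(fine t%:E) -(muI t t0).
  rewrite /= /f1 mul1r.
  by field; rewrite gt_eqF.
exists g; split => //.
have := is_derive_Rintegral (gI T).
apply: filterS; first exact: (ae_filter_ringOfSetsType mu).
move=> t /= H t0T.
have [t0 tT] := andP t0T.
have D : is_derive t 1 (fun u : R => psi 0 + \int[mu]_(s in `[0, u]) g s) (g t).
  by rewrite -[g t]add0r; apply: is_deriveD; exact: H.
apply: near_eq_is_derive D.
near=> u; rewrite [RHS]psiE //; apply/andP; split.
    by near: u; apply: lt_le_nbhsr; exact: t0.
by near: u; apply: lt_le_nbhsl; exact: tT.
Unshelve. all: by end_near. Qed.

End LipschitzDensity.

(** * Compactness of the set of configurations *)

Section Ultrafilters.

Lemma fmap_ultra {T U : Type} (f : T -> U) (F : set_system T) :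
  UltraFilter F -> UltraFilter (f @ F).
Proof.
move=> FU; split=> [|G GP FG]; first exact: fmap_proper_filter.
apply/seteqP; split => // A GA.
have [//|FnA] := in_ultra_setVsetC (f @^-1` A) FU.
have GnA : G (~` A) by exact: FG.
have : G (A `&` ~` A) by exact: filterI.
by rewrite setICr => /(@filter_not_empty _ G GP).
Qed.

Lemma compact_ultra_lim {I : Type} {X : topologicalType} (U : set_system I)
    (K : set X) (f : I -> X) : UltraFilter U -> compact K ->
  (forall i, K (f i)) -> exists2 x, K x & f @ U --> x.
Proof.
move=> UU; rewrite compact_ultra => /(_ (f @ U) (fmap_ultra f UU)) cK fK.
have [x [Kx fx]] := cK (filterS (fun i _ => fK i) filterT).
by exists x.
Qed.

End Ultrafilters.

Section Configurations.
Context {R : realType} {m n : nat}.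
Implicit Types (Omega : set 'rV[R]_m) (A : 'M[R]_(n, m)).

Lemma cvg_rows {T : Type} (F : set_system T) {FF : Filter F}
    (f : T -> 'M[R]_(n, m)) A :
  (forall i, row i (f x) @[x --> F] --> row i A) -> f @ F --> A.
Proof.
move=> fi; apply/cvgrPdist_le => e e0.
have : \forall x \near F, forall i, `|row i A - row i (f x)| <= e.
  by apply: filter_forall => i; move/cvgrPdist_le : (fi i); exact.
apply: filterS => x xi; apply: ler_norm_coord => [|i k]; first exact: ltW.
have := le_trans (ler_coord_norm (row i A - row i (f x)) 0 k) (xi i).
by rewrite !mxE.
Qed.

Lemma cvg_row {T : Type} (F : set_system T) {FF : Filter F}
    (f : T -> 'M[R]_(n, m)) A i :
  f @ F --> A -> row i (f x) @[x --> F] --> row i A.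
Proof.
move=> fA; apply/cvgrPdist_le => e e0; move/cvgrPdist_le : fA => /(_ e e0).
apply: filterS => x; apply: le_trans.
by rewrite -linearB /=; exact: ler_norm_row.
Qed.

Lemma rows_ultra_lim {I : Type} (U : set_system I) (K : set 'rV[R]_m)
    (f : I -> 'M[R]_(n, m)) : UltraFilter U -> compact K ->
  (forall j i, K (row i (f j))) ->
  exists2 A, (forall i, K (row i A)) & f @ U --> A.
Proof.
move=> UU cK fK.
have /choice[x xP] : forall i, exists x, K x /\ row i (f j) @[j --> U] --> x.
  move=> i; have [x Kx fx] := compact_ultra_lim UU cK (fK ^~ i).
  by exists x.
exists (\matrix_i x i) => [i|]; first by rewrite rowK; have [] := xP i.
by apply: cvg_rows => i; rewrite rowK; have [] := xP i.
Qed.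

Lemma compact_config Omega : bounded_set Omega ->
  compact (@config R m n Omega).
Proof.
move=> bO; rewrite compact_ultra => F FU FG.
have cO := compact_closure bO.
have [A AP fA] : exists2 A : 'M[R]_(n, m), config Omega A & F --> A.
  have H i : exists2 x, closure Omega x & row i @ F --> x.
    have FR : F (row i @^-1` closure Omega) by apply: filterS FG => X /(_ i).
    have := cO; rewrite compact_ultra => /(_ (row i @ F) (fmap_ultra _ FU) FR).
    by move=> [x [cx fx]]; exists x.
  have /choice[x xP] : forall i, exists x, closure Omega x /\ row i @ F --> x.
    by move=> i; have [x ? ?] := H i; exists x.
  exists (\matrix_i x i) => [i|]; first by rewrite rowK; have [] := xP i.
  by apply: (@cvg_rows _ F _ id) => i; rewrite rowK; have [] := xP i.
by exists A.
Qed.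

Lemma compact_fun_bounded (Omega : set 'rV[R]_m) (T : R)
    (F : 'I_n -> R -> 'M[R]_(n, m) -> 'rV[R]_m) : bounded_set Omega ->
  (forall i : 'I_n,
      {within [set` `[0, T]] `*` config Omega,
        continuous (fun z : R * 'M[R]_(n, m) => F i z.1 z.2)}) ->
  exists2 M, 0 <= M & forall i t X, 0 <= t <= T -> config Omega X ->
    `|F i t X| <= M.
Proof.
move=> bO hF.
have cA : compact ([set` `[0, T]] `*` @config R m n Omega).
  by apply: compact_setX; [exact: segment_compact|exact: compact_config].
have /choice[M MP] : forall i, exists M, forall z,
    ([set` `[0, T]] `*` config Omega) z -> `|F i z.1 z.2| <= M.
  move=> i; have [M [Mr MP]] := compact_bounded (continuous_compact (hF i) cA).
  exists (M + 1) => z zP; apply: MP; first by rewrite ltrDl.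
  by exists z.
exists (\big[Num.max/0]_i M i) => [|i t X t0T GX].
  exact: bigmax_ge_id.
apply: (le_trans (MP i (t, X) _)); first by split.
by rewrite (bigD1 i) //= le_max lexx.
Qed.

End Configurations.

(** * Euler schemes *)

Section Euler.
Context {R : realType} {m n : nat}.
Variables (Omega : set 'rV[R]_m) (nu : 'rV[R]_m -> 'rV[R]_m).
Hypotheses (oO : open Omega) (bO : bounded_set Omega).
Hypotheses (hC2 : C2_boundary Omega) (hnu : outward_unit_normal Omega nu).
Variables (T M : R) (F : 'I_n -> R -> 'M[R]_(n, m) -> 'rV[R]_m).
Hypotheses (T0 : 0 < T) (M0 : 0 <= M).
Hypothesis FM : forall i t X, 0 <= t <= T -> config Omega X -> `|F i t X| <= M.
Variable X0 : 'M[R]_(n, m).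
Hypothesis GX0 : config Omega X0.

Let K := m%:R * M + 1.

Let K0 : 0 <= K.
Proof. by rewrite addr_ge0 // mulr_ge0. Qed.

(** Explicit Euler scheme with nodes [Y] and velocities [V]. The time is clamped
    to [T] so that the scheme runs forever, which spares a case distinction at
    the final time. *)
Definition euler_scheme (e h : R) (Y V : nat -> 'M[R]_(n, m)) : Prop :=
  [/\ 0 < h <= e, Y 0%N = X0, forall j, config Omega (Y j) &
    forall j, Y j.+1 = Y j + h *: V j /\ forall i,
      admissible_velocity Omega nu K e (row i (Y j))
        (F i (Num.min T (j%:R * h)) (Y j)) (row i (V j))].

Lemma euler_scheme_exists e : 0 < e <= 1 -> exists h Y V, euler_scheme e h Y V.
Proof.
move=> /andP[e0 e1].
have : \forall h \near 0^'+, 0 < h <= e /\ forall x, closure Omega x ->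
    forall f, `|f| <= M ->
    exists2 v, admissible_velocity Omega nu (m%:R * M + e) e x f v &
      closure Omega (x + h *: v).
  near=> h; split; first (apply/andP; split).
  - by near: h; exact: nbhs_right_gt.
  - by near: h; exact: nbhs_right_ltW.
  - by near: h; exact: viable_step.
move=> /filter_ex[h [he hP]].
have /choice[step stepP] : forall p : R * 'M[R]_(n, m), exists V : 'M[R]_(n, m),
    0 <= p.1 <= T -> config Omega p.2 -> config Omega (p.2 + h *: V) /\
    forall i, admissible_velocity Omega nu K e (row i p.2) (F i p.1 p.2) (row i V).
  move=> [t X] /=; have [t0T|] := boolP (0 <= t <= T); last by exists 0.
  have [GX|] := pselect (config Omega X); last by exists 0.
  have /choice[v vP] : forall i, exists v,
      admissible_velocity Omega nu (m%:R * M + e) e (row i X) (F i t X) v /\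
      closure Omega (row i X + h *: v).
    by move=> i; have [v ? ?] := hP _ (GX i) _ (FM i t0T GX); exists v.
  exists (\matrix_i v i) => _ _; split => i.
    by rewrite linearD linearZ /= rowK; have [] := vP i.
  rewrite rowK; have [[->|[p [lam [bp /andP[l0 lK] pe ->]]]] _] := vP i.
    by left.
  right; exists p, lam; split => //; rewrite l0 /= (le_trans lK) //.
  by rewrite lerD2l.
pose tm (j : nat) := Num.min T (j%:R * h).
have tmT j : 0 <= tm j <= T.
  by case/andP: he => h0 _; rewrite /tm le_min ge_min lexx ltW //= mulr_ge0 // ltW.
pose Y := fix Y (j : nat) : 'M[R]_(n, m) :=
  if j is j'.+1 then Y j' + h *: step (tm j', Y j') else X0.
have YG j : config Omega (Y j).
  elim: j => [//|j IH] /=.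
  by have [] := stepP (tm j, Y j) (tmT j) IH.
exists h, Y, (fun j => step (tm j, Y j)); split => // j; split => //.
by have [] := stepP (tm j, Y j) (tmT j) (YG j).
Unshelve. all: by end_near. Qed.

Section Increments.
Variables (e h : R) (Y V : nat -> 'M[R]_(n, m)).
Hypothesis YV : euler_scheme e h Y V.

Let h0 : 0 < h. Proof. by case: YV => /andP[]. Qed.

Let tm_itv j : 0 <= Num.min T (j%:R * h) <= T.
Proof. by rewrite le_min ge_min lexx ltW //= mulr_ge0 // ltW. Qed.

Lemma euler_velocity_norm j : `|V j| <= M + K.
Proof.
have [_ _ YG /(_ j)[_ adm]] := YV.
apply: ler_norm_coord => [|i k]; first by rewrite addr_ge0.
have vi : `|row i (V j)| <= M + K.
  exact: (admissible_velocity_norm hnu (FM i (tm_itv j) (YG j)) K0 (adm i)).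
by have := le_trans (ler_coord_norm (row i (V j)) 0 k) vi; rewrite !mxE.
Qed.

Lemma euler_increment_norm a b : (a <= b)%N ->
  `|Y b - Y a| <= (b - a)%:R * h * (M + K).
Proof.
move=> /subnKC <-; rewrite addKn; elim: (b - a)%N => [|l IH].
  by rewrite addn0 subrr normr0 !mul0r.
have [_ _ _ /(_ (a + l)%N)[E _]] := YV.
rewrite addnS E addrAC (le_trans (ler_normD _ _)) // -natr1 !mulrDl mul1r.
by rewrite lerD // normrZ gtr0_norm // ler_pM2l // euler_velocity_norm.
Qed.

Lemma euler_increment_norm_sym a b :
  `|Y b - Y a| <= `|b%:R - a%:R| * h * (M + K).
Proof.
have [ab|/ltnW ba] := leqP a b.
  by have := euler_increment_norm ab; rewrite -natrB // normr_nat.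
by rewrite distrC (distrC b%:R) -natrB // normr_nat euler_increment_norm.
Qed.

Lemma euler_increment_dot i w c a b : (a <= b)%N ->
  (forall j, (a <= j < b)%N -> dot w (row i (V j)) <= c) ->
  dot w (row i (Y b) - row i (Y a)) <= (b - a)%:R * h * c.
Proof.
move=> /subnKC <-; rewrite addKn; elim: (b - a)%N => [|l IH] Hc.
  by rewrite addn0 subrr dot0r !mul0r.
have [_ _ _ /(_ (a + l)%N)[E _]] := YV.
rewrite addnS E linearD linearZ /= addrAC dotDr dotZr -natr1 !mulrDl mul1r.
rewrite lerD // ?ler_pM2l //; last by apply: Hc; rewrite leq_addr addnS /=.
by apply: IH => j /andP[aj jl]; apply: Hc; rewrite aj addnS ltnS ltnW.
Qed.

Definition time_index (t : R) : nat := Num.truncn (t / h).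

Lemma time_indexP t : 0 <= t ->
  (time_index t)%:R * h <= t < (time_index t)%:R * h + h.
Proof.
move=> t0; have /truncn_itv/andP[h1 h2] : 0 <= t / h by rewrite divr_ge0 // ltW.
rewrite -ler_pdivlMr // h1 /=.
by move: h2; rewrite -natr1 ltr_pdivrMr // mulrDl mul1r.
Qed.

Lemma time_index_neg t : t <= 0 -> time_index t = 0%N.
Proof.
move=> t0; apply/eqP; rewrite -leqn0 truncn_le_nat.
by rewrite (le_lt_trans _ ltr01) // ler_pdivrMr // mul0r.
Qed.

Lemma time_index_mono s t : s <= t -> (time_index s <= time_index t)%N.
Proof.
move=> st; apply: le_truncn; rewrite ler_pM2r // invr_gt0 //.
Qed.

Lemma time_index_dist s t : s <= t ->
  (time_index t - time_index s)%:R * h <= t - s + h.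
Proof.
move=> st; rewrite natrB ?time_index_mono // mulrBl.
have [s0|s0] := leP 0 s.
  have := time_indexP s0; have := time_indexP (le_trans s0 st); lra.
rewrite (time_index_neg (ltW s0)) mul0r subr0.
have [t0|t0] := leP 0 t; first by have := time_indexP t0; have := h0; lra.
rewrite (time_index_neg (ltW t0)) mul0r; have := h0; lra.
Qed.

Lemma euler_lipschitz s t :
  `|Y (time_index s) - Y (time_index t)| <= (M + K) * (`|s - t| + h).
Proof.
wlog st : s t / s <= t.
  have [st|/ltW ts] := leP s t; first exact.
  by move=> /(_ t s ts); rewrite distrC (distrC t).
rewrite distrC (distrC s) (ger0_norm (x := t - s)) ?subr_ge0 //.
apply: (le_trans (euler_increment_norm (time_index_mono st))).
have MK0 : 0 <= M + K by exact: addr_ge0.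
by rewrite mulrC ler_wpM2l // time_index_dist.
Qed.

End Increments.
End Euler.

(** * Limits of Euler schemes *)

Section EulerLimit.
Context {R : realType} {m n : nat}.
Variables (Omega : set 'rV[R]_m) (nu : 'rV[R]_m -> 'rV[R]_m).
Hypotheses (oO : open Omega) (bO : bounded_set Omega).
Hypotheses (hC2 : C2_boundary Omega) (hnu : outward_unit_normal Omega nu).
Variables (T M : R) (F : 'I_n -> R -> 'M[R]_(n, m) -> 'rV[R]_m).
Hypotheses (T0 : 0 < T) (M0 : 0 <= M).
Hypothesis FM : forall i t X, 0 <= t <= T -> config Omega X -> `|F i t X| <= M.
Variable X0 : 'M[R]_(n, m).
Hypothesis GX0 : config Omega X0.

Let K := m%:R * M + 1.
Let L := M + K.

Let L0 : 0 <= L.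
Proof. by rewrite /L /K addr_ge0 // addr_ge0 // mulr_ge0. Qed.

(** Information on the admissible velocities near [t0] and [Z] is recorded by
    half spaces: a linear inequality on velocities adds up to one on increments,
    and the latter survives in a pointwise limit although the velocities need
    not converge. *)
Definition velocity_bound (t0 : R) (Z : 'M[R]_(n, m)) i w c : Prop :=
  exists2 d, 0 < d & forall e t Y v, e <= d -> 0 <= t <= T -> `|t - t0| < d ->
    config Omega Y -> `|Y - Z| < d ->
    admissible_velocity Omega nu K e (row i Y) (F i t Y) v -> dot w v <= c.

(** The limit is taken along an ultrafilter on the indices of the schemes:
    boundedness gives a limit at all times simultaneously, without extraction
    of subsequences. The common Lipschitz constant of the schemes confines
    their nodes near a given time to a neighbourhood of the limit
    configuration, where the velocity bound applies. *)
Lemma euler_limit : exists X : R -> 'M[R]_(n, m),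
  [/\ forall t, config Omega (X t), X 0 = X0,
      forall s t, `|X s - X t| <= L * `|s - t| &
      forall t0 i w c, 0 < t0 < T -> velocity_bound t0 (X t0) i w c ->
        exists2 d, 0 < d & forall s t, t0 - d < s -> s <= t -> t < t0 + d ->
          dot w (row i (X t) - row i (X s)) <= (t - s) * c].
Proof.
have /choice[z zP] : forall k, exists z : R * (nat -> 'M[R]_(n, m)) * (nat -> 'M[R]_(n, m)),
    euler_scheme Omega nu T M F X0 (harmonic k) z.1.1 z.1.2 z.2.
  move=> k; have [|h [Y [V YV]]] := euler_scheme_exists oO bO hC2 hnu T0 M0 FM GX0
      (e := harmonic k).
    by rewrite /harmonic /= invr_gt0 ltr0n /= invf_le1 ?ler1n ?ltr0n.
  by exists (h, Y, V).
pose h k := (z k).1.1; pose Y k := (z k).1.2; pose V k := (z k).2.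
have {}zP k : euler_scheme Omega nu T M F X0 (harmonic k) (h k) (Y k) (V k) by exact: zP.
have h0 k : 0 < h k by case: (zP k) => /andP[].
have hk k : h k <= harmonic k by case: (zP k) => /andP[].
have [U [UU oU]] := @ultraFilterLemma nat \oo _.
have ecvg : harmonic @ U --> (0 : R).
  by move=> A /cvg_harmonic; exact: oU.
have hcvg : h @ U --> (0 : R).
  apply: (squeeze_cvgr _ (cvg_cst 0) ecvg).
  by apply: nearW => k; rewrite hk ltW.
pose x k t := Y k (time_index (h k) t).
have /choice[X XP] : forall t, exists A, config Omega A /\ x k t @[k --> U] --> A.
  move=> t; have [A GA xA] := rows_ultra_lim (f := x ^~ t) UU
    (compact_closure bO) (fun k i => let: And4 _ _ G _ := zP k in G _ i).
  by exists A.
have XG t : config Omega (X t) by have [] := XP t.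
have xX t : x k t @[k --> U] --> X t by have [] := XP t.
exists X; split => //.
- have cX0 : x k 0 @[k --> U] --> X0.
    apply: cvg_near_cst; apply: nearW => k; rewrite /x.
    by rewrite (time_index_neg (zP k)) //; case: (zP k).
  exact: (cvg_unique (@norm_hausdorff _ _) (xX 0) cX0).
- move=> s t.
  have xl : `|x k s - x k t| @[k --> U] --> `|X s - X t|.
    by apply: cvg_norm; apply: cvgB; exact: xX.
  have xr : L * (`|s - t| + h k) @[k --> U] --> L * (`|s - t| + 0).
    by apply: cvgM; [exact: cvg_cst|apply: cvgD => //; exact: cvg_cst].
  rewrite addr0 in xr; apply: (ler_cvg_to xl xr); apply: nearW => k.
  exact: (euler_lipschitz hnu T0 M0 FM (zP k)).
move=> t0 i w c /andP[t00 t0T] [d d0 dP].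
have L1 : 0 < 8 * (L + 1) by rewrite mulr_gt0 // ltr_wpDl.
(* Nodes between the two times lie within [3 * eta * L <= d / 2] of the node
   at [t0], itself within [d / 2] of the limit. *)
pose eta := d / (8 * (L + 1)).
have eta0 : 0 < eta by rewrite divr_gt0.
have etaE : 8 * (eta * L) + 8 * eta = d.
  by rewrite /eta; field; rewrite gt_eqF // ltr_wpDl.
have etaL : 0 <= eta * L by rewrite mulr_ge0 // ltW.
pose d' := Num.min (Num.min t0 (T - t0)) eta.
exists d'; first by rewrite !lt_min t00 subr_gt0 t0T.
have d't0 : d' <= t0 by rewrite /d' !ge_min lexx.
have d'T : d' <= T - t0 by rewrite /d' !ge_min lexx orbT.
have d'eta : d' <= eta by rewrite /d' ge_min lexx orbT.
move=> s t ls st lt.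
have s0 : 0 <= s by lra.
have t1 : 0 <= t by lra.
have xl : dot w (row i (x k t) - row i (x k s)) @[k --> U] -->
    dot w (row i (X t) - row i (X s)).
  apply: cvg_dot; first exact: cvg_cst.
  by apply: cvgB; apply: cvg_row; exact: xX.
pose N k := (time_index (h k) t - time_index (h k) s)%N.
have NE k : t - s - h k <= (N k)%:R * h k <= t - s + h k.
  rewrite /N natrB; last exact: (time_index_mono (zP k)).
  have := time_indexP (zP k) s0; have := time_indexP (zP k) t1; rewrite mulrBl.
  move=> /andP[? ?] /andP[? ?]; apply/andP; split; lra.
have xr : (N k)%:R * h k * c @[k --> U] --> (t - s) * c.
  apply: cvgM; last exact: cvg_cst.
  apply: (@squeeze_cvgr _ _ _ _ (fun k => t - s - h k) (fun k => t - s + h k)).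
  - by apply: nearW => k; exact: NE.
  - by rewrite -[X in _ --> X]subr0; apply: cvgB => //; exact: cvg_cst.
  - by rewrite -[X in _ --> X]addr0; apply: cvgD => //; exact: cvg_cst.
apply: (ler_cvg_to xl xr); near=> k.
have ek : harmonic k <= d by near: k; apply: (cvgr_le _ ecvg).
have hk1 : h k < eta by near: k; apply: (cvgr_lt _ hcvg).
have xk : `|x k t0 - X t0| < d / 2.
  by near: k; apply: cvgr_distC_lt; [exact: xX|rewrite divr_gt0].
apply: (euler_increment_dot (zP k)); first exact: (time_index_mono (zP k)).
move=> j /andP[aj jb].
have [_ _ YG /(_ j)[_ /(_ i)]] := zP k.
have hk0 := h0 k.
have /andP[h1 h2] := time_indexP (zP k) s0.
have /andP[h3 h4] := time_indexP (zP k) t1.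
have /andP[h5 h6] := time_indexP (zP k) (ltW t00).
have h7 : (time_index (h k) s)%:R * h k <= j%:R * h k by rewrite ler_pM2r // ler_nat.
have h8 : j%:R * h k <= (time_index (h k) t)%:R * h k.
  by rewrite ler_pM2r // ler_nat ltnW.
have jT : j%:R * h k <= T by lra.
rewrite min_r //; apply: dP => //.
- by rewrite mulr_ge0 // ltW.
- rewrite ltr_norml; apply/andP; split; lra.
have h9 : `|j%:R - (time_index (h k) t0)%:R| * h k <= 3 * eta.
  rewrite -[X in _ * X](gtr0_norm hk0) -normrM mulrBl.
  rewrite ler_norml; apply/andP; split; lra.
have := euler_increment_norm_sym hnu T0 M0 FM (zP k) (time_index (h k) t0) j.
move=> h10; have h11 := le_trans h10 (ler_wpM2r L0 h9).
have h12 := ler_normD (Y k j - x k t0) (x k t0 - X t0).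
rewrite addrA subrK in h12; rewrite -/(x k t0) in h11.
have : 3 * eta * L <= d / 2 by rewrite -mulrA; lra.
by move=> h13; lra.
Unshelve. all: by end_near. Qed.

End EulerLimit.

(** * Velocities of the limit trajectory *)

Section OneSidedDerivative.
Context {R : realType}.

Lemma is_derive_quotient (f : R -> R) (t d : R) : is_derive t 1 f d ->
  h^-1 * (f (h + t) - f t) @[h --> 0^'] --> d.
Proof.
move=> [fd <-]; move: fd; rewrite /derivable /derive.
under eq_fun do rewrite /GRing.scale /= mulr1.
by [].
Qed.

Lemma is_derive_le_right (f : R -> R) (t d c : R) : is_derive t 1 f d ->
  (exists2 e, 0 < e & forall s, t < s < t + e -> f s - f t <= (s - t) * c) ->
  d <= c.
Proof.
move=> /is_derive_quotient /cvg_dnbhs_at_right fd [e e0 He].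
apply: (ler_cvg_to fd (cvg_cst c)); near=> h.
have h0 : 0 < h by near: h; exact: nbhs_right_gt.
rewrite ler_pdivrMl //; have := He (h + t); rewrite addrK; apply.
rewrite ltrDr h0 addrC ltrD2l; near: h; exact: nbhs_right_lt.
Unshelve. all: by end_near. Qed.

Lemma is_derive_ge_left (f : R -> R) (t d c : R) : is_derive t 1 f d ->
  (exists2 e, 0 < e & forall s, t - e < s < t -> (t - s) * c <= f t - f s) ->
  c <= d.
Proof.
move=> /is_derive_quotient /cvg_dnbhs_at_left fd [e e0 He].
apply: (ler_cvg_to (cvg_cst c) fd); near=> h.
have h0 : h < 0 by near: h; exact: nbhs_left_lt.
have he : - e < h by near: h; apply: nbhs_left_gt; rewrite oppr_lt0.
rewrite -[leRHS]opprK -mulrN opprB -mulNr -invrN ler_pdivlMl ?oppr_gt0 //.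
have := He (h + t); rewrite opprD addrCA subrr addr0; apply.
apply/andP; split; lra.
Unshelve. all: by end_near. Qed.

Lemma is_derive_dot {m : nat} (w d : 'rV[R]_m) (x : R -> 'rV[R]_m) (t : R) :
  (forall k, is_derive t 1 (fun s : R => x s 0 k) (d 0 k)) ->
  is_derive t 1 (fun s : R => dot w (x s)) (dot w d).
Proof.
move=> xd; rewrite /dot.
have -> : (fun s : R => \sum_k w 0 k * x s 0 k) =
    \sum_k (fun s : R => w 0 k * x s 0 k).
  by apply/funext => s; rewrite fct_sumE.
by apply: is_derive_sum => k; exact: is_deriveZ.
Qed.

End OneSidedDerivative.

(** Recovers a point from the half spaces that contain it: the direction [w]
    orthogonal to [u] shows that [d - f] is a multiple of [u], and the direction
    [u] itself fixes the sign. *)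
Lemma polar_of_normal_segment {R : realType} {m : nat} (K : R)
    (f d u : 'rV[R]_m) : dot u u = 1 ->
  (forall w, dot w d <= dot w f + K * Num.max 0 (- dot w u)) ->
  exists2 lam, 0 <= lam & d = f - lam *: u.
Proof.
move=> u1 H; pose lam := - dot (d - f) u.
have [w wE] : exists w, w = d - f + lam *: u by exists (d - f + lam *: u).
have wu : dot w u = 0 by rewrite wE dotDl dotZl u1 mulr1 /lam subrr.
have w0 : w = 0.
  apply/eqP; rewrite -dot_eq0 eq_le dot_ge0 andbT.
  have := H w; rewrite wu oppr0 maxxx mulr0 addr0 -subr_le0 -dotBr.
  have -> : d - f = w - lam *: u by rewrite wE addrK.
  by rewrite dotBr dotZr wu mulr0 subr0.
have dE : d = f - lam *: u.
  by apply/eqP; rewrite -subr_eq0 opprB addrA addrAC -wE w0.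
exists lam => //.
have := H u; rewrite u1 max_l ?oppr_le0 // mulr0 addr0 -subr_le0 -dotBr.
by rewrite dotC /lam oppr_ge0.
Qed.

Section VelocityBounds.
Context {R : realType} {m n : nat}.
Variables (Omega : set 'rV[R]_m) (nu : 'rV[R]_m -> 'rV[R]_m).
Hypotheses (oO : open Omega) (hnu : outward_unit_normal Omega nu).
Variables (T M : R) (F : 'I_n -> R -> 'M[R]_(n, m) -> 'rV[R]_m).
Hypotheses (M0 : 0 <= M).
Hypothesis hF : forall i : 'I_n,
  {within [set` `[0, T]] `*` config Omega,
    continuous (fun z : R * 'M[R]_(n, m) => F i z.1 z.2)}.

Let K := m%:R * M + 1.

Let K0 : 0 < K.
Proof. by rewrite ltr_wpDl // mulr_ge0. Qed.

Lemma drift_near i t0 Z (e : R) : 0 <= t0 <= T -> config Omega Z -> 0 < e ->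
  exists2 d, 0 < d & forall t Y, 0 <= t <= T -> `|t - t0| < d ->
    config Omega Y -> `|Y - Z| < d -> `|F i t Y - F i t0 Z| <= e.
Proof.
move=> t0T GZ e0.
have Az : ([set` `[0, T]] `*` config Omega) (t0, Z) by split.
have /subspace_continuousP/(_ _ Az) := @hF i.
move=> /cvgrPdist_le/(_ _ e0); rewrite near_withinE.
move=> /nbhs_ballP[d /= d0 dP]; exists d => // t Y tT td GY Yd.
rewrite distrC; apply: (dP (t, Y)); last by split.
by split; rewrite /= ?ball_mxE /ball /= distrC.
Qed.

Lemma dot_near (w g : 'rV[R]_m) (e : R) : 0 < e ->
  exists2 d, 0 < d & forall f, `|f - g| <= d -> dot w f <= dot w g + e.
Proof.
move=> e0; have B0 : 0 < m%:R * `|w| + 1 by rewrite ltr_wpDl // mulr_ge0.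
exists (e / (m%:R * `|w| + 1)); first by rewrite divr_gt0.
move=> f fg; rewrite -lerBlDl -dotBr (le_trans (ler_dot _ _)) // mulrA.
apply: (@le_trans _ _ ((m%:R * `|w| + 1) * `|f - g|)).
  by rewrite ler_wpM2r // lerDl.
by rewrite mulrC -ler_pdivlMr.
Qed.

(** Close to an interior position there is no boundary point from which a normal
    could be taken, so that only the drift is admissible. *)
Lemma velocity_bound_interior t0 Z i w c : 0 <= t0 <= T -> config Omega Z ->
  Omega (row i Z) -> dot w (F i t0 Z) < c ->
  velocity_bound Omega nu T M F t0 Z i w c.
Proof.
move=> t0T GZ OZ wc.
have [d1 d10 d1P] := dot_near w (F i t0 Z) (e := c - dot w (F i t0 Z)) ltac:(lra).
have [d2 d20 d2P] := drift_near i t0T GZ d10.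
have [r /= r0 rP] := (nbhs_ballP _ _).1 (open_nbhs_nbhs (conj oO OZ)).
exists (Num.min d2 (r / 2)); first by rewrite lt_min d20 divr_gt0.
move=> e t Y v; rewrite !lt_min le_min => /andP[_ er] tT /andP[td _] GY /andP[Yd Yr].
case=> [->|[p [lam [bp _ pe _]]]].
  by have := d1P _ (d2P _ _ tT td GY Yd); lra.
exfalso; apply: (boundaryPn oO bp); apply: rP; rewrite /= ball_mxE.
have h1 : `|row i Y - row i Z| <= `|Y - Z| by rewrite -linearB; exact: ler_norm_row.
have h2 := ler_normB (row i Y - p) (row i Y - row i Z).
have E : row i Y - p - (row i Y - row i Z) = row i Z - p.
  by rewrite opprB addrAC addrCA subrr addr0.
rewrite E in h2; lra.
Qed.

(** The left hand side is the support function, in the direction [w], of the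
    segment of the velocities [F i t0 Z - lam *: nu] with [0 <= lam <= K]; the
    normals available nearby are close to the normal at the limit position. *)
Lemma velocity_bound_boundary t0 Z i w c : 0 <= t0 <= T -> config Omega Z ->
  boundary Omega (row i Z) ->
  dot w (F i t0 Z) + K * Num.max 0 (- dot w (nu (row i Z))) < c ->
  velocity_bound Omega nu T M F t0 Z i w c.
Proof.
set sg := _ + _ => t0T GZ bZ wc.
pose e1 := (c - sg) / 2; have e10 : 0 < e1 by rewrite divr_gt0 // subr_gt0.
have [d1 d10 d1P] := dot_near w (F i t0 Z) e10.
have [d2 d20 d2P] := drift_near i t0T GZ d10.
have [d3 d30 d3P] := dot_near (- w) (nu (row i Z)) (divr_gt0 e10 K0).
have := normal_cvg oO hnu bZ.
move=> /cvgrPdist_le/(_ _ d30); rewrite near_withinE.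
move=> /nbhs_ballP[r /= r0 rP].
exists (Num.min d2 (r / 2)); first by rewrite lt_min d20 divr_gt0.
move=> e t Y v; rewrite !lt_min le_min => /andP[_ er] tT /andP[td _] GY /andP[Yd Yr].
have wF := d1P _ (d2P _ _ tT td GY Yd).
have Kmax : 0 <= K * Num.max 0 (- dot w (nu (row i Z))).
  by rewrite mulr_ge0 ?le_max ?lexx // ltW.
have e1E : sg + e1 + e1 = c by rewrite /e1; field.
case=> [->|[p [lam [bp /andP[l0 lK] pe ->]]]]; first by rewrite /sg in e1E; lra.
have h1 : `|row i Y - row i Z| <= `|Y - Z| by rewrite -linearB; exact: ler_norm_row.
have h2 := ler_normB (row i Y - p) (row i Y - row i Z).
have E : row i Y - p - (row i Y - row i Z) = row i Z - p.
  by rewrite opprB addrAC addrCA subrr addr0.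
rewrite E in h2.
have pr : ball (row i Z) r p by rewrite ball_mxE; lra.
have := d3P (nu p); rewrite distrC => /(_ (rP _ pr bp)); rewrite !dotNl => h3.
rewrite dotBr dotZr.
have h4 : lam * - dot w (nu p) <= K * Num.max 0 (- dot w (nu (row i Z))) + e1.
  apply: (@le_trans _ _ (lam * (Num.max 0 (- dot w (nu (row i Z))) + e1 / K))).
    rewrite ler_wpM2l // (le_trans h3) // lerD2r le_max lexx orbT //.
  apply: (@le_trans _ _ (K * (Num.max 0 (- dot w (nu (row i Z))) + e1 / K))).
    rewrite ler_wpM2r // addr_ge0 ?le_max ?lexx // divr_ge0 // ltW //.
  by rewrite mulrDr mulrCA mulfV ?mulr1 // gt_eqF.
rewrite mulrN in h4; rewrite /sg in e1E; lra.
Qed.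

End VelocityBounds.

(** * Existence of a mild solution *)

Section Existence.
Context {R : realType} {m n : nat}.
Variables (Omega : set 'rV[R]_m) (nu : 'rV[R]_m -> 'rV[R]_m).
Hypotheses (oO : open Omega) (bO : bounded_set Omega).
Hypotheses (hC2 : C2_boundary Omega) (hnu : outward_unit_normal Omega nu).
Notation mu := (@lebesgue_measure R).

(** A trajectory confined to the domain touches the boundary tangentially
    wherever it is differentiable: a defining function attains its maximum
    along the trajectory at the contact time. *)
Lemma contact_tangential (x : R -> 'rV[R]_m) (L t : R) (d : 'rV[R]_m) :
  (forall s, closure Omega (x s)) ->
  (forall s s', `|x s - x s'| <= L * `|s - s'|) ->
  boundary Omega (x t) ->
  (forall k, is_derive t 1 (fun s : R => x s 0 k) (d 0 k)) ->
  dot (nu (x t)) d = 0.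
Proof.
move=> xO xL bx xd; have [U [rho [D ->]]] := hnu bx.
have [oU Ux /Cr_onW C1 _ _] := D.
set g := gradient rho (x t).
suff g0 : dot g d = 0 by rewrite dotZl g0 mulr0.
have L1 : 0 < `|L| + 1 by rewrite ltr_wpDl.
have LL s : `|x s - x t| <= (`|L| + 1) * `|s - t|.
  rewrite (le_trans (xL _ _)) // ler_wpM2r // (le_trans (ler_norm L)) //.
  by rewrite lerDl.
have near_t e : 0 < e -> exists2 r, 0 < r & forall s, `|s - t| < r ->
    dot g (x s - x t) <= e * `|s - t|.
  move=> e0; have [r r0 rP] := strict_derivative oU Ux C1 (divr_gt0 e0 L1).
  exists (r / (`|L| + 1)); first by rewrite divr_gt0.
  move=> s; rewrite ltr_pdivlMr // mulrC => sr.
  have xs : `|x s - x t| < r by exact: le_lt_trans (LL s) sr.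
  have xt : `|x t - x t| < r by rewrite subrr normr0.
  have [Us _] := rP _ _ xs xs; have [_] := rP _ _ xt xs.
  rewrite (defining_function_boundary oO D Ux bx) subr0 ler_norml => /andP[h _].
  have h2 := defining_function_closure D Us (xO s).
  have h3 : e / (`|L| + 1) * `|x s - x t| <= e * `|s - t|.
    rewrite -mulrA ler_wpM2l ?(ltW e0) // ler_pdivrMl //; exact: LL.
  rewrite /g; lra.
have gd := is_derive_dot g xd.
have le_e e : 0 < e -> dot g d <= e.
  move=> e0; have [r r0 rP] := near_t e e0.
  apply: (is_derive_le_right gd); exists r => // s /andP[ts sr].
  have := rP s; rewrite gtr0_norm ?subr_gt0 // -dotBr mulrC; apply; lra.
have ge_e e : 0 < e -> - e <= dot g d.
  move=> e0; have [r r0 rP] := near_t e e0.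
  apply: (is_derive_ge_left gd); exists r => // s /andP[ts sr].
  have := rP s; rewrite distrC gtr0_norm ?subr_gt0 // dotBr.
  move=> /(_ ltac:(lra)); lra.
apply/eqP; rewrite eq_le; apply/andP; split; rewrite leNgt; apply/negP => h.
  by have := le_e (dot g d / 2) ltac:(lra); lra.
by have := ge_e (- dot g d / 2) ltac:(lra); lra.
Qed.

Variables (T M : R) (F : 'I_n -> R -> 'M[R]_(n, m) -> 'rV[R]_m).
Hypotheses (T0 : 0 < T) (M0 : 0 <= M).
Hypothesis FM : forall i t X, 0 <= t <= T -> config Omega X -> `|F i t X| <= M.
Hypothesis hF : forall i : 'I_n,
  {within [set` `[0, T]] `*` config Omega,
    continuous (fun z : R * 'M[R]_(n, m) => F i z.1 z.2)}.

Lemma P_boundary x f : boundary Omega x ->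
  P Omega nu x f = f - Num.max 0 (dot f (nu x)) *: nu x.
Proof.
move=> bx; rewrite /P asboolT //=; case: ltP => //.
by rewrite scale0r subr0.
Qed.

Lemma P_interior x f : ~ boundary Omega x -> P Omega nu x f = f.
Proof. by move=> bx; rewrite /P asboolF. Qed.

Lemma H_norm i t X : 0 <= t <= T -> config Omega X ->
  `|H Omega nu F i t X| <= M + m%:R * M.
Proof.
move=> tT GX; have fM := FM i tT GX; have mM : 0 <= m%:R * M by rewrite mulr_ge0.
rewrite /H; have [bx|bx] := pselect (boundary Omega (row i X)); last first.
  by rewrite P_interior // (le_trans fM) // lerDl.
rewrite P_boundary // (le_trans (ler_normB _ _)) // lerD // normrZ.
rewrite ger0_norm ?le_max ?lexx // -[leRHS]mulr1.
apply: ler_pM => //; rewrite ?le_max ?lexx //; last exact: (normal_norm hnu).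
rewrite ge_max mM (le_trans (ler_dot _ _)) // ler_wpM2l // -[leRHS]mulr1.
by apply: ler_pM => //; exact: (normal_norm hnu).
Qed.

(** Although [H] jumps at the boundary, it is continuous along the trajectory
    on the closed set of contact times and on its complement. *)
Lemma measurable_H (X : R -> 'M[R]_(n, m)) i k t : t <= T ->
  continuous X -> (forall s, config Omega (X s)) ->
  measurable_fun `[0, t] (fun s => H Omega nu F i s (X s) 0 k).
Proof.
move=> tT cX GX; pose x s := row i (X s).
have cx : continuous x by move=> s; apply: cvg_row; exact: cX.
pose B : set R := x @^-1` boundary Omega.
have cB : closed B by apply: preimage_closed => [s _|]; [exact: cx|exact: closed_boundary].
have mB : measurable B by exact: closed_measurable.
have mA : measurable (`[0, t]%classic : set R) by exact: measurable_itv.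
have sT s : `[0, t]%classic s -> 0 <= s <= T.
  by rewrite /= in_itv /= => /andP[-> st]; rewrite (le_trans st).
have cF (D : set R) s : D `<=` `[0, t] -> D s ->
    F i u (X u) @[u --> within D (nbhs s)] --> F i s (X s).
  move=> DA Ds; apply/cvgrPdist_le => e e0; rewrite near_withinE.
  have [r r0 rP] := drift_near hF i (sT _ (DA _ Ds)) (GX s) e0.
  near=> u => Du; rewrite distrC; apply: rP => //; first exact/sT/DA.
  by near: u; apply: cvgr_distC_lt => //; exact: cX.
rewrite -(setUIDK `[0, t]%classic B).
apply/measurable_funU => //; [exact: measurableI|exact: measurableD|split].
- apply: (@eq_measurable_fun _ _ _ _ _ (fun s => (F i s (X s) -
      Num.max 0 (dot (F i s (X s)) (nu (x s))) *: nu (x s)) 0 k)).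
    by move=> s; rewrite inE => -[_ Bs]; rewrite /H P_boundary.
  apply: subspace_continuous_measurable_fun; first exact: measurableI.
  apply/subspace_continuousP => s [As Bs].
  have cFs := cF (`[0, t] `&` B) s (@subIsetl _ _ _) (conj As Bs).
  have cnu : nu (x u) @[u --> within (`[0, t] `&` B) (nbhs s)] --> nu (x s).
    apply/cvgrPdist_le => e e0; rewrite near_withinE.
    have := normal_cvg oO hnu Bs; move=> /cvgrPdist_le/(_ _ e0).
    rewrite near_withinE => nearB.
    have near_s : \forall u \near s, boundary Omega (x u) ->
        `|nu (x s) - nu (x u)| <= e by exact: (cx s _ nearB).
    by apply: filterS near_s => u ux [_ Bu]; exact: ux.
  apply: cvg_rV_coord; apply: cvgB => //; apply: cvgZ => //.
  by apply: cvg_max0; exact: (cvg_dot cFs cnu).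
- apply: (@eq_measurable_fun _ _ _ _ _ (fun s => F i s (X s) 0 k)).
    by move=> s; rewrite inE => -[_ nBs]; rewrite /H P_interior.
  apply: subspace_continuous_measurable_fun; first exact: measurableD.
  apply/subspace_continuousP => s Ds; apply: cvg_rV_coord.
  by apply: cF => // u [].
Unshelve. all: by end_near. Qed.

Lemma integrable_H (X : R -> 'M[R]_(n, m)) i k t : t <= T ->
  continuous X -> (forall s, config Omega (X s)) ->
  mu.-integrable `[0, t] (fun s => (H Omega nu F i s (X s) 0 k)%:E).
Proof.
move=> tT cX GX; apply: (bounded_integrable_itv (B := M + m%:R * M)).
  exact: measurable_H.
move=> s /andP[s0 st]; apply: le_trans (H_norm i _ (GX s)).
  exact: ler_coord_norm.
by rewrite s0 (le_trans st).
Qed.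

Variable X0 : 'M[R]_(n, m).
Hypothesis GX0 : config Omega X0.

(** At a time of differentiability the velocity of the limit is the drift minus
    a nonnegative multiple of the normal, by the half spaces, and tangential at
    the boundary, by contact. These two properties characterize the projected
    drift. As the limit is Lipschitz, it is the integral of its velocity. *)
Lemma mild_solution_exists : exists X : R -> 'M[R]_(n, m),
  mild_solution Omega nu F T X0 X.
Proof.
have [X [GX X00 XL Xinc]] := euler_limit oO bO hC2 hnu T0 M0 FM GX0.
set K := m%:R * M + 1 in XL Xinc; set L := M + K in XL.
have K0 : 0 <= K by rewrite addr_ge0 // mulr_ge0.
have rowL i s t : `|row i (X s) - row i (X t)| <= L * `|s - t|.
  by rewrite -linearB /= (le_trans (ler_norm_row _ _)).
have velocity t i (d : 'rV[R]_m) : 0 < t < T ->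
    (forall k, is_derive t 1 (fun s : R => row i (X s) 0 k) (d 0 k)) ->
    d = H Omega nu F i t (X t).
  move=> t0T Xd; have /andP[t0 tT] := t0T.
  have tT' : 0 <= t <= T by rewrite !ltW.
  have half w c : velocity_bound Omega nu T M F t (X t) i w c -> dot w d <= c.
    move=> vb; have [r r0 rP] := Xinc t i w c t0T vb.
    apply: (is_derive_le_right (is_derive_dot w Xd)); exists r => // s /andP[ts sr].
    by rewrite -dotBr; apply: rP; lra.
  rewrite /H; have [bx|bx] := pselect (boundary Omega (row i (X t))).
    have unit := normal_unit hnu bx.
    have [w|lam lam0 dE] := @polar_of_normal_segment _ _ K (F i t (X t)) d _ unit.
      rewrite leNgt; apply/negP => h; set s := (X in X < _) in h.
      have := half w ((s + dot w d) / 2).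
      have sc : s < (s + dot w d) / 2 by lra.
      by move=> /(_ (velocity_bound_boundary oO hnu M0 hF tT' (GX t) bx sc)); lra.
    have := contact_tangential (fun s => GX s i) (rowL i) bx Xd.
    rewrite dE dotBr dotZr unit mulr1 dotC => /eqP; rewrite subr_eq0 => /eqP E.
    by rewrite P_boundary // E max_r.
  rewrite P_interior //; apply/eqP; rewrite -subr_eq0 -dot_eq0 eq_le dot_ge0 andbT.
  have Ox := closure_notin_boundary (GX t i) bx.
  set w := d - _; rewrite {2}/w dotBr subr_le0 leNgt; apply/negP => h.
  set s := (X in X < _) in h.
  have sc : s < (s + dot w d) / 2 by lra.
  by have := half w _ (velocity_bound_interior nu oO M hF tT' (GX t) Ox sc); lra.
have cX : continuous X by exact: lipschitz_cvg XL.
exists X => i; split.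
  by apply: continuous_subspaceT => t; apply: cvg_row; exact: cX.
move=> t /andP[t0 tT]; split; [exact: GX|by move=> k; exact: integrable_H (ltW tT) _ _|].
have rowc k s s' : `|row i (X s) 0 k - row i (X s') 0 k| <= L * `|s - s'|.
  apply: le_trans (rowL i s s').
  by have := ler_coord_norm (row i (X s) - row i (X s')) 0 k; rewrite !mxE.
have /choice[g gP] := fun k => lipschitz_integral T (rowc k).
apply/rowP => k; rewrite [RHS]mxE [X in _ = _ + X]mxE -X00.
have [gi gE _] := gP k; rewrite gE ?t0 ?ltW //; congr (_ + _).
have gi' : mu.-integrable `[0, t] (EFin \o g k).
  apply: integrableS gi; [exact: measurable_itv|exact: measurable_itv|].
  by move=> s /=; rewrite !in_itv /= => /andP[-> st]; rewrite (le_trans st) // ltW.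
have Hi := integrable_H i k (ltW tT) cX GX.
have sub : `]0, t]%classic `<=` (`[0, t]%classic : set R).
  exact: subset_itv_oc_cc.
have moc : measurable (`]0, t]%classic : set (measurableTypeR R)).
  exact: measurable_itv.
have mcc : measurable (`[0, t]%classic : set (measurableTypeR R)).
  exact: measurable_itv.
have gi2 := integrableS mcc moc sub gi'; have Hi2 := integrableS mcc moc sub Hi.
rewrite -Rintegral_itv_obnd_cbnd // -[RHS]Rintegral_itv_obnd_cbnd //.
congr fine; apply: ae_eq_integral => //.
- exact: (measurable_int _ gi2).
- exact: (measurable_int _ Hi2).
have : {ae mu, forall s, forall k, 0 < s < T ->
    is_derive s 1 (fun u : R => row i (X u) 0 k) (g k s)}.
  apply: filter_forall => k'; by have [] := gP k'.
apply: filterS; first exact: (ae_filter_ringOfSetsType mu).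
move=> s sd; rewrite /= in_itv /= => /andP[s0 st]; congr EFin.
have sT : 0 < s < T by rewrite s0 (le_lt_trans st).
have <- : \row_k g k s = H Omega nu F i s (X s).
  by apply: velocity => // k'; rewrite mxE; exact: sd.
by rewrite mxE.
Qed.

End Existence.

(** * Gronwall's lemma for Lipschitz functions *)

Section Gronwall.
Context {R : realType}.
Notation mu := (@lebesgue_measure R).

(** The Cantor function shows that continuity would not do: the sign of the
    derivative almost everywhere controls [psi] because a Lipschitz function is
    the integral of its derivative. *)
Lemma lipschitz_nonincreasing (psi : R -> R) (L T t : R) :
  (forall s u, `|psi s - psi u| <= L * `|s - u|) ->
  {ae mu, forall s, 0 < s < T -> forall d, is_derive s 1 psi d -> d <= 0} ->
  0 <= t < T -> psi t <= psi 0.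
Proof.
move=> psiL psi'0 /andP[t0 tT].
have [g [gint gE gd]] := lipschitz_integral T psiL.
rewrite (gE t) ?t0 ?(ltW tT) // gerDl.
have moc : measurable (`]0, t]%classic : set (measurableTypeR R)).
  exact: measurable_itv.
have mcc : measurable (`[0, T]%classic : set (measurableTypeR R)).
  exact: measurable_itv.
have gint' : mu.-integrable `]0, t] (EFin \o g).
  apply: integrableS gint => // s; rewrite /= !in_itv /= => /andP[s0 st].
  by rewrite ltW // (le_trans st) // ltW.
rewrite -Rintegral_itv_obnd_cbnd // -oppr_ge0 -mulN1r -RintegralZl //.
have mg : measurable_fun `]0, t] g.
  by apply/measurable_EFinP; exact: (measurable_int _ gint').
have mNg : measurable_fun `]0, t] (fun s => -1 * g s) by exact: measurable_funM.
rewrite (_ : Rintegral _ _ _ = \int[mu]_(s in `]0, t]) Num.max 0 (-1 * g s)).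
  by apply: Rintegral_ge0 => s _; rewrite le_max lexx.
congr fine; apply: ae_eq_integral => //.
- exact/measurable_EFinP.
- by apply/measurable_EFinP; exact: measurable_maxr.
move: psi'0 gd; apply: filterS2; first exact: (ae_filter_ringOfSetsType mu).
move=> s H1 H2; rewrite /= in_itv /= => /andP[s0 st].
have sT : 0 < s < T by rewrite s0 (le_lt_trans st).
have gs := H1 sT _ (H2 sT).
by congr EFin; rewrite max_r // mulN1r oppr_ge0.
Qed.

(** The product of [phi] with [exp (- C t)] has a nonpositive derivative almost
    everywhere, hence is nonincreasing. Clamping the time to the segment turns
    it into a function that is Lipschitz on the whole line. *)
Lemma lipschitz_gronwall (phi : R -> R) (B C T : R) : 0 <= B -> 0 <= C ->
  phi 0 = 0 -> (forall t, 0 <= t <= T -> 0 <= phi t) ->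
  (forall s t, 0 <= s <= T -> 0 <= t <= T ->
    `|phi s - phi t| <= B * `|s - t|) ->
  {ae mu, forall t, 0 < t < T ->
    exists2 d, is_derive t 1 phi d & d <= C * phi t} ->
  forall t, 0 <= t < T -> phi t = 0.
Proof.
move=> B0 C0 phi0 phi_ge0 phiB phid t0 /andP[t00 t0T].
have T0 : 0 <= T by lra.
pose c (t : R) : R := Num.max 0 (Num.min t T).
have cT t : 0 <= c t <= T by rewrite /c le_max lexx /= ge_max T0 ge_min lexx orbT.
have cid t : 0 <= t <= T -> c t = t.
  by move=> /andP[h1 h2]; rewrite /c min_l // max_r.
have cL s t : `|c s - c t| <= `|s - t|.
  have h1 := ler_norm (s - t); have h2 := ler_norm (t - s).
  rewrite distrC in h2; rewrite /c ler_norml.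
  case: (leP s T) => sT; case: (leP t T) => tT; rewrite ?(max_r T0);
    try case: (leP 0 s) => s0; try case: (leP 0 t) => ?; apply/andP; split; lra.
pose E t := expR (- (C * c t)).
have E0 t : 0 < E t by exact: expR_gt0.
have E1 t : E t <= 1.
  by rewrite -expR0 ler_expR oppr_le0 mulr_ge0 //; case/andP: (cT t).
have EL s t : `|E s - E t| <= C * `|s - t|.
  wlog st : s t / c s <= c t.
    have [|/ltW] := leP (c s) (c t); first by move=> st; exact.
    by move=> ts /(_ t s ts); rewrite distrC (distrC t).
  have Ets : E t <= E s by rewrite ler_expR lerN2 ler_wpM2l.
  rewrite ger0_norm ?subr_ge0 //.
  apply: (@le_trans _ _ (C * (c t - c s))); last first.
    rewrite ler_wpM2l // (le_trans (ler_norm _)) // distrC; exact: cL.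
  have -> : E t = E s * expR (- (C * (c t - c s))).
    by rewrite /E -expRD; congr expR; ring.
  have := expR_ge1Dx (- (C * (c t - c s))); set e := expR _ => h.
  have h2 : 0 <= E s * (e - (1 - C * (c t - c s))).
    by rewrite mulr_ge0 ?(ltW (E0 s)) // subr_ge0.
  have h3 : 0 <= (1 - E s) * (C * (c t - c s)).
    by rewrite mulr_ge0 ?subr_ge0 ?E1 // mulr_ge0 // subr_ge0.
  nra.
pose psi t := E t * phi (c t).
have phiM t : `|phi (c t)| <= B * T.
  have /andP[c0 c1] := cT t; have := phiB (c t) 0 (cT t).
  rewrite lexx phi0 !subr0 => /(_ T0)/le_trans; apply.
  by rewrite ler_wpM2l // ger0_norm.
have psiL s t : `|psi s - psi t| <= (C * (B * T) + B) * `|s - t|.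
  have -> : psi s - psi t = (E s - E t) * phi (c s) + E t * (phi (c s) - phi (c t)).
    by rewrite /psi; ring.
  rewrite (le_trans (ler_normD _ _)) // [leRHS]mulrDl !normrM; apply: lerD.
    by rewrite mulrAC; apply: ler_pM.
  rewrite -[leRHS]mul1r ler_pM // ?(ltW (normr_gt0 _)) //.
    by rewrite gtr0_norm.
  by rewrite (le_trans (phiB _ _ (cT s) (cT t))) // ler_wpM2l.
have psi_le : psi t0 <= psi 0.
  apply: (lipschitz_nonincreasing psiL (T := T)); last by rewrite t00.
  move: phid; apply: filterS; first exact: (ae_filter_ringOfSetsType mu).
  move=> t phid tT d psid; have [d' phid' d'C] := phid tT.
  have /andP[t1 t2] := tT.
  have near_t : \forall u \near t, expR (- (C * u)) * phi u = psi u.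
    near=> u; rewrite /psi /E cid //; apply/andP; split.
      by near: u; apply: lt_le_nbhsr; exact: t1.
    by near: u; apply: lt_le_nbhsl; exact: t2.
  have dE : is_derive t 1 (fun u : R => expR (- (C * u))) (expR (- (C * t)) * - C).
    have dl : is_derive t 1 (fun u : R => - (C * u)) (- C).
      have := is_deriveN (is_deriveZ C (is_derive_id t 1)).
      by rewrite /GRing.scale /= mulr1.
    exact: (is_derive1_comp (is_derive_expR _) dl).
  have D := is_deriveM dE phid'.
  have := near_eq_is_derive near_t D.
  move=> psid'; rewrite -(@derive_val _ _ _ _ _ _ _ psid) (@derive_val _ _ _ _ _ _ _ psid').
  rewrite /GRing.scale /= mulrCA -mulrDr mulr_ge0_le0 ?expR_ge0 //.
  lra.
have t0T' : 0 <= t0 <= T by rewrite t00 ltW.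
have c0 : c 0 = 0 by apply: cid; rewrite lexx.
move: psi_le; rewrite /psi c0 (cid t0) // phi0 mulr0 pmulr_rle0 //.
by move=> h; apply/eqP; rewrite eq_le h phi_ge0.
Unshelve. all: by end_near. Qed.

End Gronwall.

(** * Distance of two mild solutions *)

Section Uniqueness.
Context {R : realType} {m n : nat}.
Variables (Omega : set 'rV[R]_m) (nu : 'rV[R]_m -> 'rV[R]_m).
Hypotheses (oO : open Omega) (bO : bounded_set Omega).
Hypotheses (hC2 : C2_boundary Omega) (hnu : outward_unit_normal Omega nu).
Notation mu := (@lebesgue_measure R).
Variables (T M : R) (F : 'I_n -> R -> 'M[R]_(n, m) -> 'rV[R]_m).
Hypotheses (T0 : 0 < T) (M0 : 0 <= M).
Hypothesis FM : forall i t X, 0 <= t <= T -> config Omega X -> `|F i t X| <= M.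
Variable X0 : 'M[R]_(n, m).

Let B := M + m%:R * M.

Let B0 : 0 <= B.
Proof. by rewrite addr_ge0 // mulr_ge0. Qed.

Lemma mild_solution0 X : mild_solution Omega nu F T X0 X -> X 0 = X0.
Proof.
move=> XP; apply/row_matrixP => i; have [_ /(_ 0)] := XP i.
rewrite lexx T0 => /(_ isT)[_ _ ->]; apply/rowP => k.
by rewrite !mxE set_itv1 Rintegral_set1 addr0.
Qed.

Lemma mild_solution_config X t : mild_solution Omega nu F T X0 X ->
  0 <= t < T -> config Omega (X t).
Proof. by move=> XP tT i; have [_ /(_ t tT)[]] := XP i. Qed.

Lemma mild_solution_coord X t i k : mild_solution Omega nu F T X0 X ->
  0 <= t < T -> mu.-integrable `[0, t]
      (EFin \o (fun s => H Omega nu F i s (X s) 0 k)) /\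
    X t i k = X0 i k + \int[mu]_(s in `[0, t]) H Omega nu F i s (X s) 0 k.
Proof.
move=> XP tT; have [_ /(_ t tT)[_ Hint /rowP/(_ k)]] := XP i.
by rewrite !mxE => E; split => //; exact: Hint.
Qed.

Lemma mild_solution_lipschitz X s t : mild_solution Omega nu F T X0 X ->
  0 <= s < T -> 0 <= t < T -> `|X s - X t| <= B * `|s - t|.
Proof.
move=> XP; wlog st : s t / s <= t.
  have [st|/ltW ts] := leP s t; first exact.
  by move=> W sT tT; rewrite distrC (distrC s); exact: W.
move=> /andP[s0 sT] /andP[t0 tT]; rewrite distrC (distrC s).
apply: ler_norm_coord => [|i k]; first by rewrite mulr_ge0.
have tTT : 0 <= t < T by rewrite t0.
have sTT : 0 <= s < T by rewrite s0.
have [Hi Xt] := mild_solution_coord i k XP tTT.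
have [_ Xs] := mild_solution_coord i k XP sTT.
rewrite !mxE Xt Xs opprD addrACA subrr add0r Rintegral_itvB //.
have moc : measurable (`]s, t]%classic : set (measurableTypeR R)).
  exact: measurable_itv.
have mcc : measurable (`[0, t]%classic : set (measurableTypeR R)).
  exact: measurable_itv.
have Hi' : mu.-integrable `]s, t]
    (EFin \o (fun s => H Omega nu F i s (X s) 0 k)).
  apply: integrableS Hi => // u; rewrite /= !in_itv /= => /andP[su ->].
  by rewrite andbT ltW // (le_lt_trans s0).
rewrite (le_trans (le_normr_Rintegral moc Hi')) //.
have -> : B * `|t - s| = \int[mu]_(u in `]s, t]) B.
  rewrite Rintegral_cst //; congr (_ * _).
  rewrite ger0_norm ?subr_ge0 //; rewrite [X in fine X]lebesgue_measure_itv /=.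
  rewrite lte_fin; move: st; rewrite le_eqVlt => /orP[/eqP ->|->] //.
  by rewrite ltxx subrr.
apply: le_Rintegral => //.
- have := integrable_abse Hi'.
  by rewrite (_ : (abse \o _)%E = EFin \o (fun u => `|H Omega nu F i u (X u) 0 k|)).
- have cI : mu.-integrable `[s, t] (EFin \o cst B).
    by apply: (bounded_integrable_itv (B := B)) => // ? _; rewrite ger0_norm.
  by apply: integrableS cI => //; exact: subset_itv_oc_cc.
move=> u; rewrite /= in_itv /= => /andP[su ut].
apply: (le_trans (ler_coord_norm _ _ _)); apply: (H_norm hnu M0 FM).
  by rewrite (le_trans s0) ?(ltW su) //= (le_trans ut) // ltW.
by apply: (mild_solution_config XP); rewrite (le_trans s0) ?(ltW su) //= (le_lt_trans ut).
Qed.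

Lemma mild_solution_derive X T' : mild_solution Omega nu F T X0 X ->
  0 < T' < T ->
  {ae mu, forall t, 0 < t < T' -> forall i k,
    is_derive t 1 (fun s : R => X s i k) (H Omega nu F i t (X t) 0 k)}.
Proof.
move=> XP /andP[T'0 T'T].
have T'TT : 0 <= T' < T by rewrite ltW.
have D i k : {ae mu, forall t, 0 < t < T' ->
    is_derive t 1 (fun s : R => X s i k) (H Omega nu F i t (X t) 0 k)}.
  have [Hi _] := mild_solution_coord i k XP T'TT.
  have := is_derive_Rintegral Hi.
  apply: filterS; first exact: (ae_filter_ringOfSetsType mu).
  move=> t Ht tT'; have /andP[t0 tT] := tT'.
  have D : is_derive t 1 (fun u : R => X0 i k +
      \int[mu]_(s in `[0, u]) H Omega nu F i s (X s) 0 k)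
      (H Omega nu F i t (X t) 0 k).
    by rewrite -[H _ _ _ _ _ _ 0 k]add0r; apply: is_deriveD; exact: Ht.
  apply: near_eq_is_derive D; near=> u.
  have uT : 0 <= u < T.
    apply/andP; split; first by near: u; apply: lt_le_nbhsr; exact: t0.
    rewrite (le_lt_trans _ T'T) //; near: u; apply: lt_le_nbhsl; exact: tT.
  by have [_ ->] := mild_solution_coord i k XP uT.
have : {ae mu, forall t, forall i k, 0 < t < T' ->
    is_derive t 1 (fun s : R => X s i k) (H Omega nu F i t (X t) 0 k)}.
  by apply: filter_forall => i; apply: filter_forall => k; exact: D.
apply: filterS; first exact: (ae_filter_ringOfSetsType mu).
by move=> t h tT' i k; exact: h.
Unshelve. all: by end_near. Qed.

Lemma H_decomposition i t X : 0 <= t <= T -> config Omega X ->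
  exists a, [/\ 0 <= a <= m%:R * M, boundary Omega (row i X) \/ a = 0 &
    H Omega nu F i t X = F i t X - a *: nu (row i X)].
Proof.
move=> tT GX; have mM : 0 <= m%:R * M by rewrite mulr_ge0.
rewrite /H; have [bx|bx] := pselect (boundary Omega (row i X)); last first.
  exists 0; split; [by rewrite lexx|by right|].
  by rewrite P_interior // scale0r subr0.
exists (Num.max 0 (dot (F i t X) (nu (row i X)))); split; [|by left|exact: P_boundary].
rewrite le_max lexx ge_max mM (le_trans (ler_dot _ _)) // ler_wpM2l //.
rewrite -[leRHS]mulr1; apply: ler_pM => //; [exact: FM|exact: (normal_norm hnu)].
Qed.

(** The squared Euclidean norm of all the coordinates: unlike [maxnorm], it is
    differentiable along a trajectory wherever the coordinates are. *)
Definition energy (Z : 'M[R]_(n, m)) : R := \sum_i dot (row i Z) (row i Z).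

Lemma dot_row_energy Z i : dot (row i Z) (row i Z) <= energy Z.
Proof. by rewrite /energy (bigD1 i) //= lerDl sumr_ge0 // => j _; exact: dot_ge0. Qed.

Lemma energy_ge0 Z : 0 <= energy Z.
Proof. by apply: sumr_ge0 => i _; exact: dot_ge0. Qed.

Lemma energy_eq0 Z : energy Z = 0 -> Z = 0.
Proof.
move=> Z0; apply/row_matrixP => i; rewrite row0; apply/eqP; rewrite -dot_eq0.
by rewrite eq_le dot_ge0 -Z0 dot_row_energy.
Qed.

Lemma maxnorm_energy Z : maxnorm Z <= Num.sqrt (energy Z).
Proof.
apply: bigmax_le => [|i _]; first exact: sqrtr_ge0.
by apply: ler_wsqrtr; exact: dot_row_energy.
Qed.

Lemma norm_row_energy Z i : `|row i Z| <= Num.sqrt (energy Z).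
Proof.
apply: le_trans (ler_norm_enorm _) _; apply: ler_wsqrtr; exact: dot_row_energy.
Qed.

Lemma energy_lipschitz Z W D : `|Z| <= D -> `|W| <= D ->
  `|energy Z - energy W| <= n%:R * (m%:R * (2 * D)) * `|Z - W|.
Proof.
move=> ZD WD; rewrite /energy -sumrB (le_trans (ler_norm_sum _ _ _)) //.
rewrite -mulrA mulr_natl -[X in _ *+ X]card_ord -sumr_const.
apply: ler_sum => i _.
have -> : dot (row i Z) (row i Z) - dot (row i W) (row i W) =
    dot (row i Z - row i W) (row i Z + row i W).
  by rewrite !dotE (dotC (row i W) (row i Z)); ring.
rewrite (le_trans (ler_norm_dot _ _)) // -mulrA ler_wpM2l // mulrC.
apply: ler_pM => //; last by rewrite -linearB; exact: ler_norm_row.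
rewrite mulr2n mulrDl mul1r (le_trans (ler_normD _ _)) // lerD //.
  exact: le_trans (ler_norm_row _ _) ZD.
exact: le_trans (ler_norm_row _ _) WD.
Qed.

(** The outward component removed from the drift can separate two configurations
    only through the curvature of the boundary, that is, quadratically. *)
Lemma one_sided_lipschitz (L : R) : 0 < L ->
  (forall (t : R) (X Y : 'M[R]_(n, m)) (i : 'I_n),
        0 <= t <= T -> config Omega X -> config Omega Y ->
        enorm (F i t X - F i t Y) <= L * maxnorm (X - Y)) ->
  exists2 C, 0 <= C & forall t X Y i, 0 <= t <= T ->
    config Omega X -> config Omega Y ->
    dot (row i (X - Y)) (H Omega nu F i t X - H Omega nu F i t Y) <=
      C * energy (X - Y).
Proof.
move=> L0 FL; have [Ce Ce0 CeP] := exterior_ball oO bO hC2 hnu.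
have mM : 0 <= m%:R * M by rewrite mulr_ge0.
exists (m%:R * L + 2 * (m%:R * M * Ce)).
  by rewrite addr_ge0 ?mulr_ge0 // ltW.
move=> t X Y i tT GX GY; set Z := X - Y; set z := row i Z.
have zE : z = row i X - row i Y by rewrite /z /Z linearB.
have S2 : Num.sqrt (energy Z) * Num.sqrt (energy Z) = energy Z.
  by rewrite -expr2 sqr_sqrtr // energy_ge0.
have zS : `|z| <= Num.sqrt (energy Z) by exact: norm_row_energy.
have z2 : `|z| ^+ 2 <= energy Z.
  exact: le_trans (ler_sqr_norm_dot _) (dot_row_energy _ _).
have FS : `|F i t X - F i t Y| <= L * Num.sqrt (energy Z).
  rewrite (le_trans (ler_norm_enorm _)) // (le_trans (FL _ _ _ _ tT GX GY)) //.
  by rewrite ler_pM2l // maxnorm_energy.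
have [a [/andP[a0 aM] ab ->]] := H_decomposition i tT GX.
have [b [/andP[b0 bM] bb ->]] := H_decomposition i tT GY.
have push c x y : 0 <= c <= m%:R * M -> boundary Omega x \/ c = 0 ->
    closure Omega y -> `|y - x| ^+ 2 <= energy Z ->
    c * dot (nu x) (y - x) <= m%:R * M * Ce * energy Z.
  move=> /andP[c0 cM] [bx|->] cy yx; last first.
    by rewrite mul0r mulr_ge0 ?energy_ge0 // mulr_ge0.
  apply: (@le_trans _ _ (c * (Ce * `|y - x| ^+ 2))).
    by rewrite ler_wpM2l // CeP.
  rewrite -mulrA; apply: ler_pM => //; first by rewrite mulr_ge0 // sqr_ge0.
  by rewrite ler_wpM2l.
have h1 : a * dot (nu (row i X)) (row i Y - row i X) <= m%:R * M * Ce * energy Z.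
  by apply: push => //; [rewrite a0|rewrite distrC -zE].
have h2 : b * dot (nu (row i Y)) (row i X - row i Y) <= m%:R * M * Ce * energy Z.
  by apply: push => //; [rewrite b0|rewrite -zE].
have h3 : dot z (F i t X - F i t Y) <= m%:R * L * energy Z.
  rewrite (le_trans (ler_dot _ _)) // -mulrA ler_wpM2l // -S2 mulrCA.
  apply: (@le_trans _ _ (Num.sqrt (energy Z) * (L * Num.sqrt (energy Z)))).
    exact: ler_pM.
  by rewrite mulrCA.
rewrite -opprB -zE dotNr mulrN in h1; rewrite -zE in h2.
have -> : F i t X - a *: nu (row i X) - (F i t Y - b *: nu (row i Y)) =
    F i t X - F i t Y - a *: nu (row i X) + b *: nu (row i Y).
  by rewrite opprB addrACA addrA addrAC -addrA addrAC; apply/rowP => k; rewrite !mxE; ring.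
rewrite dotDr dotBr !dotZr (dotC z (nu (row i X))) (dotC z (nu (row i Y))).
rewrite mulrDl; lra.
Qed.

(** The distance of two solutions, measured by [energy], satisfies the hypotheses
    of the Gronwall lemma on every segment that ends before [T]. *)
Lemma mild_solution_unique_interior (L : R) X Y t : 0 < L ->
  (forall (t : R) (X Y : 'M[R]_(n, m)) (i : 'I_n),
        0 <= t <= T -> config Omega X -> config Omega Y ->
        enorm (F i t X - F i t Y) <= L * maxnorm (X - Y)) ->
  mild_solution Omega nu F T X0 X -> mild_solution Omega nu F T X0 Y ->
  0 <= t < T -> X t = Y t.
Proof.
move=> L0 FL XP YP /andP[t0 tT].
have [C C0 CP] := one_sided_lipschitz L0 FL.
have [T' [T'0 T'T tT']] : exists T', [/\ 0 < T', T' < T & t < T'].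
  by exists ((t + T) / 2); split; lra.
have inT s : 0 <= s <= T' -> 0 <= s < T by lra.
pose phi s := energy (X s - Y s).
have Z0 : X 0 - Y 0 = 0 by rewrite (mild_solution0 XP) (mild_solution0 YP) subrr.
have ZL s u : 0 <= s <= T' -> 0 <= u <= T' ->
    `|(X s - Y s) - (X u - Y u)| <= 2 * B * `|s - u|.
  move=> /inT sT /inT uT.
  have -> : X s - Y s - (X u - Y u) = X s - X u - (Y s - Y u).
    by rewrite !opprB addrACA [RHS]addrACA (addrC (- Y s)).
  rewrite (le_trans (ler_normB _ _)) // -mulrA mulr2n mulrDl mul1r lerD //;
    exact: mild_solution_lipschitz.
have ZB s : 0 <= s <= T' -> `|X s - Y s| <= 2 * B * T'.
  move=> sT; have /andP[s0 s1] := sT; have := ZL s 0 sT.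
  rewrite lexx Z0 !subr0 => /(_ (ltW T'0))/le_trans; apply.
  by rewrite ler_wpM2l ?mulr_ge0 // ger0_norm.
apply/eqP; rewrite -subr_eq0; apply/eqP/energy_eq0.
apply: (@lipschitz_gronwall _ phi
  (n%:R * (m%:R * (2 * (2 * B * T'))) * (2 * B)) (n%:R * 2 * C) T').
- by rewrite !mulr_ge0 // ltW.
- by rewrite !mulr_ge0.
- by rewrite /phi Z0 /energy big1 // => i _; rewrite row0 dot0r.
- by move=> s _; exact: energy_ge0.
- move=> s u sT uT; rewrite /phi -mulrA.
  apply: (le_trans (energy_lipschitz (ZB s sT) (ZB u uT))).
  by rewrite ler_wpM2l ?ZL // !mulr_ge0 // ltW.
- have T'TT : 0 < T' < T by rewrite T'0.
  have := mild_solution_derive XP T'TT; have := mild_solution_derive YP T'TT.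
  apply: filterS2; first exact: (ae_filter_ringOfSetsType mu).
  move=> s Yd Xd sT'; have {}Xd := Xd sT'; have {}Yd := Yd sT'.
  pose HX i := H Omega nu F i s (X s); pose HY i := H Omega nu F i s (Y s).
  have sT : 0 <= s <= T by lra.
  have sT2 : 0 <= s < T by lra.
  exists (\sum_i 2 * dot (row i (X s - Y s)) (HX i - HY i)).
    have -> : phi = \sum_i \sum_k (fun u : R => (X u i k - Y u i k) ^+ 2).
      apply/funext => u; rewrite /phi /energy !fct_sumE; apply: eq_bigr => i _.
      by rewrite fct_sumE; apply: eq_bigr => k _; rewrite !mxE expr2.
    have -> : \sum_i 2 * dot (row i (X s - Y s)) (HX i - HY i) =
        \sum_i \sum_k 2 * ((X s i k - Y s i k) * (HX i 0 k - HY i 0 k)).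
      apply: eq_bigr => i _; rewrite /dot mulr_sumr; apply: eq_bigr => k _.
      by rewrite !mxE.
    apply: is_derive_sum => i; apply: is_derive_sum => k.
    have D : is_derive s 1 (fun u : R => X u i k - Y u i k) (HX i 0 k - HY i 0 k).
      exact: (is_deriveB (Xd i k) (Yd i k)).
    have := is_deriveM D D; rewrite /GRing.scale /= => DD.
    have -> : 2 * ((X s i k - Y s i k) * (HX i 0 k - HY i 0 k)) =
      (X s i k - Y s i k) * (HX i 0 k - HY i 0 k) +
      (X s i k - Y s i k) * (HX i 0 k - HY i 0 k) by ring.
    exact: DD.
  have -> : n%:R * 2 * C * phi s = \sum_(i < n) 2 * (C * phi s).
    by rewrite sumr_const card_ord -[RHS]mulr_natl !mulrA.
  apply: ler_sum => i _; rewrite ler_pM2l //.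
  by apply: CP => //; [exact: (mild_solution_config XP)|exact: (mild_solution_config YP)].
- by rewrite t0.
Qed.

End Uniqueness.

(** * Existence and uniqueness up to the final time *)

(** The integral equation ignores the final time, which is recovered by
    continuity. *)
Lemma continuous_itv_eq_right {R : realType} {V : normedModType R}
    (f g : R -> V) (T : R) : 0 < T ->
  {within `[0, T], continuous f} -> {within `[0, T], continuous g} ->
  (forall t, 0 <= t < T -> f t = g t) -> f T = g T.
Proof.
move=> T0 cf cg fg.
have cT (h : R -> V) : {within `[0, T], continuous h} -> h t @[t --> T^'-] --> h T.
  by case/(continuous_within_itvP _ T0).
apply: (cvg_unique (@norm_hausdorff _ _) (cT _ cf)).
refine (cvg_trans (near_eq_cvg _) (cT _ cg)); near=> t.
apply: esym; apply: fg; apply/andP; split.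
  by apply: ltW; near: t; exact: nbhs_left_gt.
by near: t; exact: nbhs_left_lt.
Unshelve. all: by end_near. Qed.

Theorem theorem2p4 (R : realType) (m n : nat) (hn : (1 <= n)%N)
    (Omega : set 'rV[R]_m) (hOmega : bounded_domain Omega)
    (hC2 : C2_boundary Omega)
    (nu : 'rV[R]_m -> 'rV[R]_m) (hnu : outward_unit_normal Omega nu)
    (T : R) (hT : 0 < T)
    (X0 : 'M[R]_(n, m)) (hX0 : config Omega X0)
    (F : 'I_n -> R -> 'M[R]_(n, m) -> 'rV[R]_m)
    (hF : forall i : 'I_n,
      {within [set` `[0, T]] `*` config Omega,
        continuous (fun z : R * 'M[R]_(n, m) => F i z.1 z.2)}) :
  (exists X : R -> 'M[R]_(n, m), mild_solution Omega nu F T X0 X) /\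
  ((exists2 L : R, 0 < L &
      forall (t : R) (X Y : 'M[R]_(n, m)) (i : 'I_n),
        0 <= t <= T -> config Omega X -> config Omega Y ->
        enorm (F i t X - F i t Y) <= L * maxnorm (X - Y)) ->
   forall X Y : R -> 'M[R]_(n, m),
     mild_solution Omega nu F T X0 X -> mild_solution Omega nu F T X0 Y ->
     forall t, 0 <= t <= T -> X t = Y t).
Proof.
have [oO _ _ bO] := hOmega.
have [M M0 FM] := compact_fun_bounded bO hF.
split; first exact: (mild_solution_exists oO bO hC2 hnu hT M0 FM hF hX0).
move=> [L L0 FL] X Y XP YP t /andP[t0 tT].
have XY s : 0 <= s < T -> X s = Y s.
  exact: (mild_solution_unique_interior oO bO hC2 hnu hT M0 FM L0 FL XP YP).
move: tT; rewrite le_eqVlt => /orP[/eqP ->|tT]; last by apply: XY; rewrite t0.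
apply/row_matrixP => i.
apply: (@continuous_itv_eq_right _ _ (fun t => row i (X t)) (fun t => row i (Y t)) _ hT).
- by have [] := XP i.
- by have [] := YP i.
- by move=> s sT; rewrite XY.
Qed.
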